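(* Fix a compact set $\mathcal C\subset(0,1)^2$. For integers $N,K,n$ with $(\kappa,\eta):=(K/N,\,n/N)\in\mathcal C$, let $X\sim\mathrm{Hyp}(N,K,n)$, with mean $\mu=nK/N$ and variance $\sigma^2=\frac{nK(N-K)(N-n)}{N^2(N-1)}$, put $\nu=\lceil\mu\rceil$, $h=\nu-\mu\in[0,1)$, and $$a=\kappa\eta,\qquad b=\kappa(1-\eta),\qquad c=\eta(1-\kappa),\qquad d=(1-\kappa)(1-\eta).$$ For $m\ge1$ define $$W_m=\kappa^{-m}+(1-\kappa)^{-m}+\eta^{-m}+(1-\eta)^{-m},\qquad \widehat\Xi_m=(a^{-m}+d^{-m})+(-1)^{m+1}(b^{-m}+c^{-m}),$$ $$\tilde a_m(h)=\frac{(-1)^{m+1}}{m(m+1)}\Bigl[(W_m-1)\,B_{m+1}-\widehat\Xi_m\,B_{m+1}(h)\Bigr].$$ Then, as $N\to\infty$ with $(\kappa,\eta)\in\mathcal C$, uniformly, $$\mathbb E|X-\mu|\sim\sqrt{\frac{2Nad}{\pi}}\;\exp\Bigl(\sum_{m\ge1}\frac{\tilde a_m(h)}{N^m}\Bigr),$$ in the following sense: with $\delta_0=1$ and $\delta_m=\frac1m\sum_{k=1}^mk\,\tilde a_k(h)\,\delta_{m-k}$ for $m\ge1$, for every integer $M\ge0$ there exist constants $C$ and $N_0$ depending only on $M$ and $\mathcal C$ such that for all integers $N\ge N_0$ and all integers $K,n$ with $(K/N,n/N)\in\mathcal C$, $$\Bigl|\;\mathbb E|X-\mu|\Big/\sqrt{\frac{2Nad}{\pi}}-\sum_{m=0}^{M}\frac{\delta_m}{N^m}\Bigr|\le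 C\,N^{-M-1}.$$ Here $Nad=nK(N-K)(N-n)/N^3=\sigma^2(N-1)/N$. In particular, $$\tilde a_1=\frac1{12}\Bigl[\frac1{\kappa(1-\kappa)}+\frac1{\eta(1-\eta)}-1\Bigr]-\frac{B_2(h)}{2ad}.$$
   Context: $B_k(t)$ and $B_k=B_k(0)$ are the Bernoulli polynomials and numbers: $\frac{z e^{tz}}{e^z-1}=\sum_{k\ge0}B_k(t)\frac{z^k}{k!}$. $\mathrm{Hyp}(N,K,n)$ has mass function $P(k)=\binom Kk\binom{N-K}{n-k}/\binom Nn$, with $\binom{m}{j}=0$ for $j<0$ or $j>m$. The numbers $\delta_m$ are the coefficients of the formal re-expansion $\exp(\sum_{k\ge1}\tilde a_kx^{-k})=\sum_{m\ge0}\delta_mx^{-m}$. *)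

(* Defs.v *)
From HB Require Import structures.
From mathcomp Require Import all_boot all_order all_algebra.
From mathcomp Require Import all_classical all_reals all_analysis.
Set Implicit Arguments.
Unset Strict Implicit.
Unset Printing Implicit Defensive.
Import Order.TTheory GRing.Theory Num.Theory.
Import numFieldNormedType.Exports.
Local Open Scope ring_scope.

Section CourseOfValues.
Variable R : realType.
Implicit Types F : nat -> seq R -> R.

(* [F m s] computes the m-th term of a sequence u from the list
   s = [:: u (m-1); ...; u 0] of the earlier ones, the latest first. *)
Fixpoint cov_seq F (m : nat) : seq R :=
  if m is m'.+1 then F m' (cov_seq F m') :: cov_seq F m' else [::].

Definition cov F (m : nat) : R := F m (cov_seq F m).

Lemma nth_cov_seq F m k : (k < m)%N -> (cov_seq F m)`_k = cov F (m - k.+1).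
Proof.
elim: m k => // m IH [|k] km /=; first by rewrite subn1.
by rewrite IH // subSS.
Qed.

End CourseOfValues.

Section FormalSeries.
Variable R : realType.
Implicit Types f g a : nat -> R.

(* A formal power series is its sequence of coefficients. *)
Definition fps_mul f g (m : nat) : R := \sum_(k < m.+1) f k * g (m - k)%N.

(* The quotient f / g, meaningful when g 0 != 0. *)
Definition fps_div f g : nat -> R :=
  cov (fun m s => (f m - \sum_(k < m) g k.+1 * s`_k) / g 0%N).

Lemma fps_mul_div f g : g 0%N != 0 -> fps_mul g (fps_div f g) =1 f.
Proof.
move=> g0 m; rewrite /fps_mul big_ord_recl subn0.
rewrite {1}/fps_div /cov mulrC divfK //=.
rewrite (eq_bigr (fun k : 'I_m => g k.+1 * fps_div f g (m - k.+1)%N)).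
  by rewrite subrK.
by move=> k _; rewrite nth_cov_seq.
Qed.

(* The coefficients of exp(t z). *)
Definition fps_exp (t : R) (m : nat) : R := t ^+ m / m`!%:R.

Lemma fps_exp0 t : fps_exp t 0 = 1.
Proof. by rewrite /fps_exp expr0 divr1. Qed.

(* B_k(t) is k! times the coefficient of z^k in
   z exp(t z) / (exp z - 1) = exp(t z) / ((exp z - 1) / z). *)
Definition bernoulli_poly (k : nat) (t : R) : R :=
  k`!%:R * fps_div (fps_exp t) (fun m => fps_exp 1 m.+1) k.

Definition bernoulli_num (k : nat) : R := bernoulli_poly k 0.

(* (exp z - 1) * \sum_k B_k(t) z^k / k! = z exp(t z). *)
Lemma bernoulli_genfun (t : R) (m : nat) :
  fps_mul (fun k => fps_exp 1 k - (k == 0)%:R)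
          (fun k => bernoulli_poly k t / k`!%:R) m
  = if m is m'.+1 then fps_exp t m' else 0.
Proof.
rewrite /fps_mul big_ord_recl /= fps_exp0 subrr mul0r add0r.
case: m => [|m]; first by rewrite big_ord0.
rewrite -(@fps_mul_div (fps_exp t) (fun m => fps_exp 1 m.+1)); last first.
  by rewrite /fps_exp expr1n mul1r invr_eq0 pnatr_eq0.
apply: eq_bigr => k _; rewrite /bump /= subr0 subSS; congr (_ * _).
by rewrite mulrAC divff ?mul1r // pnatr_eq0 -lt0n fact_gt0.
Qed.

(* With a_k the coefficient of x^-k in A (a_0 is ignored), the coefficients
   of exp A: delta_0 = 1, delta_m = m^-1 \sum_(1 <= k <= m) k a_k delta_(m-k). *)
Definition exp_coef a : nat -> R :=
  cov (fun m s => if m == 0%N then 1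
                  else m%:R^-1 * \sum_(k < m) k.+1%:R * a k.+1 * s`_k).

Lemma exp_coef0 a : exp_coef a 0 = 1.
Proof. by []. Qed.

Lemma exp_coefS a m : (0 < m)%N ->
  exp_coef a m =
  m%:R^-1 * \sum_(1 <= k < m.+1) k%:R * a k * exp_coef a (m - k).
Proof.
case: m => // m _; rewrite {1}/exp_coef /cov [m.+1 == 0%N]/=.
rewrite big_add1 big_mkord; congr (_ * _).
by apply: eq_bigr => k _; rewrite nth_cov_seq.
Qed.

End FormalSeries.

Section Hypergeometric.
Variable R : realType.
Implicit Types N K n : nat.

(* The truncated n - k would give 'C(N - K, 0) = 1 for k > n, whence the test. *)
Definition hyp_pmf N K n (k : nat) : R :=
  if (k <= n)%N then ('C(K, k) * 'C(N - K, n - k))%N%:R / 'C(N, n)%:R else 0.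

Lemma hyp_pmf_sum1 N K n : (K <= N)%N -> (n <= N)%N ->
  \sum_(k < n.+1) hyp_pmf N K n k = 1.
Proof.
move=> KN nN; have := binomial.Vandermonde K (N - K)%N n; rewrite subnKC // => V.
rewrite (eq_bigr (fun k : 'I_n.+1 =>
  ('C(K, k) * 'C(N - K, n - k))%N%:R / 'C(N, n)%:R)); last first.
  by move=> k _; rewrite /hyp_pmf -ltnS ltn_ord.
by rewrite -mulr_suml -natr_sum V divff // pnatr_eq0 -lt0n bin_gt0.
Qed.

Definition has_hyp_law (d : measure_display) (T : measurableType d)
    (P : probability T R) (X : {RV P >-> R}) N K n : Prop :=
  forall k : nat, P (X @^-1` [set k%:R])%classic = (hyp_pmf N K n k)%:E.

Definition hyp_mean N K n : R := n%:R * K%:R / N%:R.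

Definition hyp_var N K n : R :=
  (n%:R * K%:R * (N%:R - K%:R) * (N%:R - n%:R)) / (N%:R ^+ 2 * (N%:R - 1)).

Definition hyp_frac N K n : R :=
  (Num.ceil (hyp_mean N K n))%:~R - hyp_mean N K n.

End Hypergeometric.

Section Coefficients.
Variable R : realType.
Implicit Types kappa eta h : R.

Definition cella kappa eta : R := kappa * eta.
Definition cellb kappa eta : R := kappa * (1 - eta).
Definition cellc kappa eta : R := eta * (1 - kappa).
Definition celld kappa eta : R := (1 - kappa) * (1 - eta).

Definition W kappa eta (m : nat) : R :=
  kappa ^- m + (1 - kappa) ^- m + eta ^- m + (1 - eta) ^- m.

Definition Xihat kappa eta (m : nat) : R :=
  (cella kappa eta ^- m + celld kappa eta ^- m)
  + (-1) ^+ m.+1 * (cellb kappa eta ^- m + cellc kappa eta ^- m).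

Definition atilde kappa eta h (m : nat) : R :=
  (-1) ^+ m.+1 / (m%:R * m.+1%:R) *
  ((W kappa eta m - 1) * bernoulli_num R m.+1
   - Xihat kappa eta m * bernoulli_poly m.+1 h).

Definition delta kappa eta h : nat -> R := exp_coef (atilde kappa eta h).

End Coefficients.

(* Main.v *)
Require Import Defs.
From HB Require Import structures.
From mathcomp Require Import all_boot all_order all_algebra.
From mathcomp Require Import zify ring lra.
From mathcomp Require Import all_classical all_reals all_analysis.
From mathcomp Require Import measurable_realfun.
Set Implicit Arguments.
Unset Strict Implicit.
Unset Printing Implicit Defensive.
Import Order.TTheory GRing.Theory Num.Theory.
Import numFieldNormedType.Exports.
Local Open Scope ring_scope.

(** With T(k) = k (N - K - n + k) P(k) / N one has (k - mu) P(k) = T(k) - T(k+1),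
    so the mean absolute deviation telescopes to 2 T(nu), a quotient of
    factorials.  Each factorial (q-1)! with q = x + h is expanded by a shifted
    Stirling series, whose coefficients are the Bernoulli polynomials at h: here
    x is N, K, n, N - K, N - n with h = 0, then N a and N d with the given h, and
    N b and N c with 1 - h.  The reflection formula for Bernoulli polynomials
    merges the nine series into the logarithm of the prefactor plus
    \sum_m atilde_m / N^m, which is then exponentiated.

    The Stirling series is obtained by checking that its difference
    S(x+1) - S(x) agrees with ln (x+h) up to O(x^-(M+2)) and telescoping; the
    constant comes from Wallis' bounds on the central binomial coefficient. *)

(** The shift by h is what turns the expansion into one in powers of 1/N: each of the nine arguments
    is exactly N times a function of kappa and eta, plus 0, h or 1 - h, so the position of mu
    between two integers enters only through the Bernoulli polynomials. The constants have to be
    uniform in kappa, eta and h, so every step is a finite identity with a bounded remainder.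
    Compactness provides eps with both proportions in [eps, 1 - eps]; then each x is at least eps^2
    N. The Stirling bound is uniform in h because its constant comes from the one-step error alone.
    The comparison with Wallis has a constant that depends on h, but it is used only in the limit n
    -> infinity. It identifies the additive constant through 2 r(n) - r(2n), with r the remainder:
    if r tends to c, so does this combination, and its factorials are those of a central binomial
    coefficient. The exponentiation rests on the differential equation G' = P' G, which is what the
    recursion for delta says coefficient by coefficient. *)

(** * Formal power series and Bernoulli polynomials *)

Section PowerSeriesAlgebra.
Variable R : realType.
Implicit Types (f g e : nat -> R) (s t h : R).

(** Coefficients below n of a Cauchy product depend only on truncations, so commutativity and
    associativity are inherited from the ring [{poly R}]. *)
Let trunc n f : {poly R} := \poly_(i < n) f i.

Let coef_truncM n f g m : (m < n)%N -> (trunc n f * trunc n g)`_m = fps_mul f g m.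
Proof.
move=> mn; rewrite coefM; apply: eq_bigr => k _; rewrite !coef_poly.
by rewrite (leq_ltn_trans _ mn) ?(leq_ltn_trans (leq_subr _ _) mn) // -ltnS.
Qed.

Lemma fps_mulC f g : fps_mul f g =1 fps_mul g f.
Proof. by move=> m; rewrite -!(@coef_truncM m.+1) // mulrC. Qed.

Lemma fps_mulA f g e : fps_mul f (fps_mul g e) =1 fps_mul (fps_mul f g) e.
Proof.
move=> m; transitivity ((trunc m.+1 f * (trunc m.+1 g * trunc m.+1 e))`_m).
  rewrite coefM; apply: eq_bigr => k _.
  by rewrite coef_truncM ?ltnS ?leq_subr // coef_poly ltn_ord.
rewrite mulrA coefM; apply: eq_bigr => k _.
by rewrite coef_truncM // coef_poly ltnS leq_subr.
Qed.

Lemma eq_fps_mul f f' g g' : f =1 f' -> g =1 g' -> fps_mul f g =1 fps_mul f' g'.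
Proof. by move=> ff' gg' m; apply: eq_bigr => k _; rewrite ff' gg'. Qed.

Lemma fps_mul_inj g f f' : g 0%N != 0 ->
  fps_mul g f =1 fps_mul g f' -> f =1 f'.
Proof.
move=> g0 gff' m; elim/ltn_ind: m => m IH.
have := gff' m; rewrite /fps_mul !big_ord_recl subn0.
rewrite (eq_bigr (fun k : 'I_m => g k.+1 * f' (m - k.+1)%N)).
  by move/addIr/(mulfI g0).
move=> k _; rewrite lift0 IH // ltn_subrL /=.
exact: leq_ltn_trans (ltn_ord k).
Qed.

Lemma fps_expD s t : fps_mul (fps_exp s) (fps_exp t) =1 fps_exp (s + t).
Proof.
move=> m; rewrite fps_mulC /fps_exp (addrC s) exprDn mulr_suml.
rewrite fps_mulC; apply: eq_bigr => k _.
have km : (k <= m)%N by rewrite -ltnS.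
have := bin_fact km; move/(congr1 (fun n => n%:R : R)); rewrite !natrM => bf.
have kf : k`!%:R != 0 :> R by rewrite pnatr_eq0 -lt0n fact_gt0.
have mkf : (m - k)`!%:R != 0 :> R by rewrite pnatr_eq0 -lt0n fact_gt0.
have bn : 'C(m, k)%:R != 0 :> R by rewrite pnatr_eq0 -lt0n bin_gt0.
by rewrite -bf -mulr_natr; field; rewrite bn kf mkf.
Qed.

(** The substitution of -z for z. *)
Definition fps_neg f m : R := (-1) ^+ m * f m.

Lemma fps_neg_mul f g :
  fps_mul (fps_neg f) (fps_neg g) =1 fps_neg (fps_mul f g).
Proof.
move=> m; rewrite /fps_neg /fps_mul mulr_sumr; apply: eq_bigr => k _.
have km : (k <= m)%N by rewrite -ltnS.
have -> : (-1) ^+ m = (-1) ^+ k * (-1) ^+ (m - k) :> R.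
  by rewrite -exprD subnKC.
ring.
Qed.

Lemma fps_neg_exp t : fps_neg (fps_exp t) =1 fps_exp (- t).
Proof. by move=> m; rewrite /fps_neg /fps_exp (exprNn t) mulrA. Qed.

(** The series (exp z - 1) / z, the denominator in the generating function of the Bernoulli
    polynomials. *)
Let e1 (m : nat) : R := fps_exp 1 m.+1.

(** This is exp z (1 - exp(-z)) / z = (exp z - 1) / z, read off from the vanishing of the
    coefficients of positive degree in exp z exp(-z). *)
Let e1_neg : fps_mul (fps_exp 1) (fps_neg e1) =1 e1.
Proof.
move=> m; have := fps_expD 1 (-1) m.+1.
have -> : fps_exp (1 - 1 : R) m.+1 = 0 by rewrite /fps_exp subrr expr0n mul0r.
rewrite /fps_mul big_ord_recr /= subnn.
rewrite fps_exp0 mulr1 => /eqP; rewrite addrC addr_eq0 /e1 => /eqP ->.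
rewrite -sumrN; apply: eq_bigr => k _.
have km : (k <= m)%N by rewrite -ltnS.
rewrite subSn // /fps_neg /fps_exp !expr1n exprS; ring.
Qed.

Let e1_neq0 : e1 0 != 0.
Proof. by rewrite /e1 /fps_exp expr1n divr1 oner_eq0. Qed.

Lemma bernoulli_poly_fact t k :
  bernoulli_poly k t / k`!%:R = fps_div (fps_exp t) e1 k.
Proof.
by rewrite /bernoulli_poly mulrAC divff ?mul1r // pnatr_eq0 -lt0n fact_gt0.
Qed.

(** Replacing z by -z in exp((1 - h) z) / [e1] gives exp(h z) / [e1], because [e1] at -z is exp(-z)
    times [e1]. The two quotients are compared after multiplication by [e1]. *)
Lemma bernoulli_poly_reflect k h :
  bernoulli_poly k (1 - h) = (-1) ^+ k * bernoulli_poly k h.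
Proof.
pose b t := fps_div (fps_exp t) e1.
suff nb : fps_neg (b (1 - h)) =1 b h.
  have kf : k`!%:R != 0 :> R by rewrite pnatr_eq0 -lt0n fact_gt0.
  have := nb k; rewrite /fps_neg /b -!bernoulli_poly_fact mulrA => /(mulIf _).
  move=> /(_ (invr_neq0 kf)) <-.
  by rewrite mulrA -exprD -signr_odd oddD addbb mul1r.
apply: (fps_mul_inj e1_neq0) => m.
rewrite fps_mul_div //.
have -> : fps_mul e1 (fps_neg (b (1 - h))) m
        = fps_mul (fps_mul (fps_exp 1) (fps_neg e1)) (fps_neg (b (1 - h))) m.
  by apply: eq_fps_mul => // j; rewrite e1_neg.
rewrite -fps_mulA.
have -> : fps_exp h m = fps_exp (1 + - (1 - h)) m by congr fps_exp; ring.
rewrite -fps_expD; apply: eq_fps_mul => // j.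
rewrite fps_neg_mul -fps_neg_exp; congr (_ * _).
exact: fps_mul_div.
Qed.

(** Coefficient of z^p in [e1] times the generating function, equal to exp(t z), multiplied by
    (p+1)!. *)
Lemma bernoulli_poly_rec p t :
  \sum_(j < p.+1) 'C(p.+1, j)%:R * bernoulli_poly j t = p.+1%:R * t ^+ p.
Proof.
have := fps_mul_div (fps_exp t) e1_neq0 p; rewrite fps_mulC => H.
have pf : p.+1`!%:R != 0 :> R by rewrite pnatr_eq0 -lt0n fact_gt0.
have pf' : p`!%:R != 0 :> R by rewrite pnatr_eq0 -lt0n fact_gt0.
transitivity (p.+1`!%:R * fps_exp t p); last first.
  by rewrite /fps_exp factS natrM; field.
rewrite -H /fps_mul mulr_sumr; apply: eq_bigr => k _.
rewrite -bernoulli_poly_fact /e1 /fps_exp expr1n.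
have km : (k <= p)%N by rewrite -ltnS.
have := bin_fact (leqW km); move/(congr1 (fun n => n%:R : R)).
rewrite subSn // (natrM _ 'C(_, _)) (natrM _ k`!) => <-.
have kf : k`!%:R != 0 :> R by rewrite pnatr_eq0 -lt0n fact_gt0.
have mkf : (p - k).+1`!%:R != 0 :> R by rewrite pnatr_eq0 -lt0n fact_gt0.
by field; rewrite ?kf ?mkf.
Qed.

Lemma bernoulli_poly0 t : bernoulli_poly 0 t = 1.
Proof. by have := bernoulli_poly_rec 0 t; rewrite big_ord1 expr0 bin0 !mul1r. Qed.

Lemma bernoulli_poly1 t : bernoulli_poly 1 t = t - 2^-1.
Proof.
have := bernoulli_poly_rec 1 t.
rewrite !big_ord_recl big_ord0 /= bernoulli_poly0 /bump /= bin0 bin1 => H.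
lra.
Qed.

Lemma bernoulli_poly2 t : bernoulli_poly 2 t = t ^+ 2 - t + 6^-1.
Proof.
have := bernoulli_poly_rec 2 t.
rewrite !big_ord_recl big_ord0 /= bernoulli_poly0 bernoulli_poly1 /bump /=.
rewrite bin0 bin1 (_ : 'C(3, _) = 3%N) // => H; lra.
Qed.

(** The recursion can be solved for its last term, (k+1) B_k(h), so bounds on [0, 1] propagate by
    strong induction. *)
Lemma bernoulli_poly_bounded k :
  exists D : R, forall h, 0 <= h <= 1 -> `|bernoulli_poly k h| <= D.
Proof.
elim/ltn_ind: k => k IH.
have [D HD] : exists D : nat -> R, forall j, (j < k)%N ->
    forall h, 0 <= h <= 1 -> `|bernoulli_poly j h| <= D j.
  have /choice[D HD] : forall j, exists D : R, (j < k)%N ->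
      forall h, 0 <= h <= 1 -> `|bernoulli_poly j h| <= D.
    move=> j; have [jk|_] := boolP (j < k)%N; last by exists 0.
    by have [D ?] := IH _ jk; exists D.
  by exists D.
exists (1 + \sum_(j < k) 'C(k.+1, j)%:R * D j) => h h01.
have := bernoulli_poly_rec k h; rewrite big_ord_recr /= binSn => H.
have E := esym (addrK (\sum_(j < k) 'C(k.+1, j)%:R * bernoulli_poly j h)
                      (k.+1%:R * bernoulli_poly k h)).
rewrite (addrC (_ * _)) H in E.
have k0 : (0 : R) < k.+1%:R by rewrite ltr0n.
rewrite -(ler_pM2l k0) -{1}(ger0_norm (ltW k0)) -normrM E.
apply: (le_trans (ler_normB _ _)); rewrite mulrDr mulr1; apply: lerD.
  have /andP[h0 h1] := h01.
  rewrite ger0_norm ?mulr_ge0 ?exprn_ge0 //.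
  by rewrite ler_piMr ?exprn_ile1 // (ltW k0).
apply: (le_trans (ler_norm_sum _ _ _)).
rewrite -[leLHS]mul1r; apply: ler_pM => //.
- by apply: sumr_ge0.
- by rewrite ler1n.
apply: ler_sum => j _; rewrite normrM ger0_norm // ler_wpM2l //.
exact: HD.
Qed.
End PowerSeriesAlgebra.

(** * Mean, variance and mean absolute deviation by telescoping *)

Section HypergeometricMoments.
Variable R : realType.
Variables N K n : nat.
Hypotheses (KN : (K <= N)%N) (nN : (n <= N)%N) (N0 : (0 < N)%N).
Let p (k : nat) : R := hyp_pmf R N K n k.
Let mu : R := hyp_mean R N K n.

(** The difference m - k is taken in R, possibly negative; this is harmless since 'C(m, k) vanishes
    when k > m. *)
Lemma bin_succR (m k : nat) :
  k.+1%:R * 'C(m, k.+1)%:R = (m%:R - k%:R) * 'C(m, k)%:R :> R.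
Proof.
rewrite -natrM mul_bin_left natrM; have [km|mk] := leqP k m.
  by rewrite natrB.
by rewrite bin_small // !mulr0.
Qed.

(* The partial sums of (mu - k) P(k), in closed form. *)
Definition hyp_tail (k : nat) : R :=
  k%:R * (N%:R - K%:R - n%:R + k%:R) * p k / N%:R.

Let NR0 : N%:R != 0 :> R. Proof. by rewrite pnatr_eq0 -lt0n. Qed.

(** The ratio of consecutive point masses, (k+1)(N-K-n+k+1) P(k+1) = (K-k)(n-k) P(k). At k = n both
    sides are 0, the left one through the test in [hyp_pmf]. *)
Lemma hyp_tailS k : (k <= n)%N ->
  hyp_tail k.+1 = (K%:R - k%:R) * (n%:R - k%:R) * p k / N%:R.
Proof.
rewrite leq_eqVlt => /predU1P[->|kn].
  by rewrite /hyp_tail /p {1}/hyp_pmf ltnn subrr !(mulr0, mul0r).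
rewrite /hyp_tail /p /hyp_pmf kn ltnW //; congr (_ / _).
rewrite !natrM !mulrA; congr (_ / _).
have := bin_succR K k; have := bin_succR (N - K) (n - k.+1).
rewrite subnSK // !natrB // => [e2 e1|]; last exact: ltnW.
have -> : k.+1%:R * (N%:R - K%:R - n%:R + k.+1%:R) * 'C(K, k.+1)%:R
    * 'C(N - K, n - k.+1)%:R = k.+1%:R * 'C(K, k.+1)%:R *
      ((N%:R - K%:R - (n%:R - k.+1%:R)) * 'C(N - K, n - k.+1)%:R) :> R by ring.
by rewrite e1 -e2; ring.
Qed.

(** Reduces to k(N-K-n+k) - (K-k)(n-k) = N k - n K. *)
Lemma hyp_tail_diff k : (k <= n)%N ->
  (k%:R - mu) * p k = hyp_tail k - hyp_tail k.+1.
Proof.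
by move=> kn; rewrite hyp_tailS // /hyp_tail /mu /hyp_mean; field.
Qed.

Lemma hyp_tail0 : hyp_tail 0 = 0.
Proof. by rewrite /hyp_tail !mul0r. Qed.

Lemma hyp_tail_end : hyp_tail n.+1 = 0.
Proof. by rewrite hyp_tailS // subrr mulr0 !mul0r. Qed.

Lemma hyp_tail_sum i j : (i <= j <= n.+1)%N ->
  \sum_(i <= k < j) (k%:R - mu) * p k = hyp_tail i - hyp_tail j.
Proof.
move=> /andP[ij jn]; rewrite -opprB -(telescope_sumr _ ij) -sumrN.
apply: eq_big_nat => k /andP[_ kj]; rewrite hyp_tail_diff ?opprB //.
by rewrite -ltnS (leq_trans kj).
Qed.

Lemma hyp_sum_mean : \sum_(k < n.+1) k%:R * p k = mu.
Proof.
have : \sum_(0 <= k < n.+1) (k%:R - mu) * p k = 0.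
  by rewrite hyp_tail_sum ?leqnn // hyp_tail0 hyp_tail_end subrr.
under eq_bigr do rewrite mulrBl.
rewrite sumrB -mulr_sumr !big_mkord hyp_pmf_sum1 // mulr1.
by move/eqP; rewrite subr_eq0 => /eqP.
Qed.

(** On either side of [nu] the deviation has constant sign, and since the tail vanishes at 0 and at
    n+1, each side contributes [hyp_tail nu]. *)
Lemma hyp_sum_abs_dev nu : (nu <= n.+1)%N ->
  (forall k, (k < nu)%N -> k%:R <= mu) ->
  (forall k, (nu <= k)%N -> mu <= k%:R) ->
  \sum_(k < n.+1) `|k%:R - mu| * p k = 2 * hyp_tail nu.
Proof.
move=> nun lo hi; rewrite -(big_mkord xpredT (fun k => `|k%:R - mu| * p k)).
rewrite (big_cat_nat (leq0n nu)) //=.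
rewrite (eq_big_nat _ _ (F2 := fun k => - ((k%:R - mu) * p k))); last first.
  by move=> k /andP[_ /lo kmu]; rewrite ler0_norm ?subr_le0 // mulNr.
rewrite sumrN hyp_tail_sum // hyp_tail0 sub0r opprK.
rewrite (eq_big_nat _ _ (F2 := fun k => (k%:R - mu) * p k)); last first.
  by move=> k /andP[/hi kmu _]; rewrite ger0_norm ?subr_ge0.
by rewrite hyp_tail_sum ?nun ?leqnn // hyp_tail_end; ring.
Qed.

(** Summation by parts turns V into the sum of the T(k+1). On the other hand N T(k+1) = (K-k)(n-k)
    P(k), and expanding this product around mu gives N V = V + (K-mu)(n-mu), which is solved for
    V. *)
Lemma hyp_sum_variance : (1 < N)%N ->
  \sum_(k < n.+1) (k%:R - mu) ^+ 2 * p k = hyp_var R N K n.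
Proof.
move=> N1; set V := \sum_(k < _) _.
have V1 : V = \sum_(k < n.+1) hyp_tail k.+1.
  rewrite /V (eq_bigr (fun k : 'I_n.+1 =>
    k%:R * hyp_tail k - k%:R * hyp_tail k.+1 - mu * ((k%:R - mu) * p k))); last first.
    move=> k _; have kn : (k <= n)%N by rewrite -ltnS.
    by rewrite -mulrBr -hyp_tail_diff //; ring.
  rewrite sumrB -mulr_sumr -(big_mkord xpredT (fun k => (k%:R - mu) * p k)).
  rewrite hyp_tail_sum ?leqnn // hyp_tail0 hyp_tail_end subrr mulr0 subr0 sumrB.
  rewrite big_ord_recl mul0r add0r.
  rewrite [X in _ - X](_ : _ = \sum_(k < n) k%:R * hyp_tail k.+1); last first.
    by rewrite big_ord_recr /= hyp_tail_end mulr0 addr0.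
  rewrite -sumrB big_ord_recr /= hyp_tail_end addr0.
  apply: eq_bigr => k _.
  by rewrite -[bump 0 k]/k.+1 -mulrBl -natr1 addrAC subrr add0r mul1r.
have V2 : V * (N%:R - 1) = (K%:R - mu) * (n%:R - mu).
  suff E : V * N%:R = V + (K%:R - mu) * (n%:R - mu).
    by rewrite mulrBr mulr1 E addrAC subrr add0r.
  rewrite {1}V1 mulr_suml.
  rewrite (eq_bigr (fun k : 'I_n.+1 => (k%:R - mu) ^+ 2 * p k
     + (2 * mu - K%:R - n%:R) * ((k%:R - mu) * p k)
     + (K%:R - mu) * (n%:R - mu) * p k)); last first.
    by move=> k _; rewrite hyp_tailS // ?divfK //; [ring|rewrite -ltnS].
  rewrite !big_split /= -!mulr_sumr hyp_pmf_sum1 // mulr1.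
  rewrite -(big_mkord xpredT (fun k => (k%:R - mu) * p k)).
  by rewrite hyp_tail_sum ?leqnn // hyp_tail0 hyp_tail_end subrr mulr0 addr0.
have N10 : N%:R - 1 != 0 :> R by rewrite subr_eq0 pnatr_eq1 gtn_eqF.
rewrite -[LHS](mulfK N10) V2 /hyp_var /mu /hyp_mean; field.
by rewrite NR0 N10.
Qed.

End HypergeometricMoments.

(** * Expectations under the law as finite sums *)

Section HypergeometricLaw.
Context (R : realType) (d : measure_display) (T : measurableType d)
  (P : probability T R) (X : {RV P >-> R}) (N K n : nat).
Hypotheses (KN : (K <= N)%N) (nN : (n <= N)%N) (hX : has_hyp_law X N K n).

(** The law prescribes only the masses of the points. Those of 0, ..., n add up to 1, so outside a
    null set g(X) is a finite combination of indicators. *)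
Lemma hyp_expectation (g : R -> R) : measurable_fun setT g ->
  ('E_P[fun w => g (X w)] =
   (\sum_(k < n.+1) g k%:R * hyp_pmf R N K n k)%:E)%E.
Proof.
move=> mg; pose A k := (X @^-1` [set k%:R])%classic.
have mA k : measurable (A k) by exact: measurable_sfunP.
pose U := (\big[setU/set0]_(k < n.+1) A k)%classic.
have PU : P U = 1%E.
  rewrite measure_bigsetU_ord //; first last.
    move=> i j _ _ [w [Ai Aj]]; apply/val_inj/eqP.
    by rewrite -(eqr_nat R) -[i%:R]Ai -[j%:R]Aj.
  rewrite (eq_bigr (fun k : 'I_n.+1 => (hyp_pmf R N K n k)%:E)).
    by rewrite sumEFin hyp_pmf_sum1.
  by move=> k _; exact: hX.
have mU : measurable U by apply: bigsetU_measurable.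
have PCU : P (~` U)%classic = 0%E by rewrite probability_setC // PU subee.
rewrite unlock.
have mgX : measurable_fun [set: T] (fun w : T => (g (X w))%:E).
  by apply/measurable_EFinP; apply: measurableT_comp.
have int k : (P.-integrable [set: T] (fun w : T => (g k%:R)%:E * (\1_(A k) w)%:E))%E.
  apply: integrableZl => //; exact: integrable_indic.
rewrite (ae_eq_integral
  (fun w : T => \sum_(k < n.+1) (g k%:R)%:E * (\1_(A k) w)%:E)%E) //.
- rewrite integral_sum // -sumEFin; apply: eq_bigr => k _.
  rewrite integralZl ?integral_indic ?setIT ?EFinM -?hX //.
  exact: integrable_indic.
- by apply: emeasurable_sum => k; have /integrableP[] := int k.
exists (~` U)%classic; split => //; first exact: measurableC.
move=> w /= nw Uw; apply: nw => _.
have [k _ Ak] : exists2 k : 'I_n.+1, True & A k w.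
  move: Uw; rewrite /U -bigcup_mkord => -[k kn Ak].
  by exists (Ordinal (kn : (k < n.+1)%N)).
rewrite (bigD1 k) //= big1 ?adde0; last first.
  move=> j jk; rewrite indicE memNset ?mule0 // => Aj.
  move: jk; rewrite -val_eqE /= -(eqr_nat R); rewrite -Aj -Ak eqxx //.
by rewrite indicE mem_set // mule1 Ak.
Qed.

End HypergeometricLaw.

(** * Taylor estimates for the logarithm and for negative powers *)

Section ElementaryAnalysis.
Variable R : realType.
Implicit Types (f df : R -> R) (x y u : R).

Lemma mvt_seg f df y : 0 <= y ->
  (forall x, 0 <= x <= y -> is_derive x 1 f (df x)) ->
  exists2 c, 0 <= c <= y & f y - f 0 = df c * y.
Proof.
move=> y0 fdf.
have [x||c] := @MVT_segment R f df 0 y y0.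
- by rewrite in_itv /= => /andP[/ltW x0 /ltW xy]; apply: fdf; rewrite x0.
- apply: derivable_within_continuous => z; rewrite in_itv /= => /fdf.
  by case.
- by rewrite in_itv /= subr0 => c0y ->; exists c.
Qed.

Lemma mvt_norm_le f df y B : 0 <= y ->
  (forall x, 0 <= x <= y -> is_derive x 1 f (df x)) ->
  (forall x, 0 <= x <= y -> `|df x| <= B) -> `|f y - f 0| <= B * y.
Proof.
move=> y0 fdf dfB; have [c cy ->] := mvt_seg y0 fdf.
by rewrite normrM (ger0_norm y0) ler_wpM2r // dfB.
Qed.

Lemma geom_altern n x : (\sum_(j < n) (- x) ^+ j) * (1 + x) = 1 - (- x) ^+ n.
Proof.
elim: n => [|n IH]; first by rewrite big_ord0 mul0r expr0 subrr.
by rewrite big_ord_recr /= mulrDl IH exprS; ring.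
Qed.

(** The remainder has derivative (-x)^n / (1+x), at most y^n in absolute value on [0, y]; the mean
    value theorem supplies the last factor y. There is no smallness condition on y. *)
Lemma ln1D_taylor n y : 0 <= y ->
  `|ln (1 + y) - \sum_(j < n) (-1) ^+ j / j.+1%:R * y ^+ j.+1| <= y ^+ n.+1.
Proof.
move=> y0.
pose P : {poly R} := \sum_(j < n) ((-1) ^+ j / j.+1%:R) *: 'X^(j.+1).
have PE x : P.[x] = \sum_(j < n) (-1) ^+ j / j.+1%:R * x ^+ j.+1.
  by rewrite /P horner_sum; apply: eq_bigr => j _; rewrite hornerZ hornerXn.
have dPE x : P^`().[x] = \sum_(j < n) (- x) ^+ j.
  rewrite /P linear_sum /= horner_sum; apply: eq_bigr => j _.
  rewrite derivZ derivXn hornerZ hornerMn hornerXn /= mulrnAr -mulrnAl -mulr_natr.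
  by rewrite divfK ?pnatr_eq0 // [RHS]exprNn.
have D x : 0 <= x <= y ->
    is_derive x 1 (fun x => ln (1 + x) - P.[x]) ((1 + x)^-1 - P^`().[x]).
  move=> /andP[x0 _]; apply: is_deriveB.
  rewrite -[(1 + x)^-1]mulr1.
  apply: (@is_derive1_comp _ (@ln R) (fun x => 1 + x)).
    by apply: is_derive1_ln; lra.
  by rewrite -[X in is_derive _ _ _ X]add0r; apply: is_deriveD.
have B x : 0 <= x <= y -> `|(1 + x)^-1 - P^`().[x]| <= y ^+ n.
  move=> /andP[x0 xy]; have x1 : 0 < 1 + x by lra.
  have xi : 0 <= (1 + x)^-1 by rewrite invr_ge0 ltW.
  have -> : (1 + x)^-1 - P^`().[x] = (- x) ^+ n / (1 + x).
    by rewrite dPE -[X in _ - X](mulfK (lt0r_neq0 x1)) geom_altern; field; lra.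
  rewrite normrM normrX normrN (ger0_norm x0) (ger0_norm xi).
  apply: (@le_trans _ _ (x ^+ n)); last by rewrite lerXn2r.
  by rewrite ler_piMr ?exprn_ge0 // invf_le1 //; lra.
have := mvt_norm_le y0 D B.
rewrite addr0 ln1 sub0r opprK [P.[0]]PE big1 ?addr0; last first.
  by move=> j _; rewrite expr0n mulr0.
by rewrite PE -exprSr.
Qed.

(** Truncated form of (1+u) (1+u)^-(m+2) = (1+u)^-(m+1): Pascal's rule leaves a single boundary
    term. *)
Lemma negative_binomial_sum m n u :
  (1 + u) * \sum_(j < n) (-1) ^+ j * 'C(m.+1 + j, m.+1)%:R * u ^+ j =
  \sum_(j < n) (-1) ^+ j * 'C(m + j, m)%:R * u ^+ j
  - (-1) ^+ n * 'C(m + n, m.+1)%:R * u ^+ n.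
Proof.
elim: n => [|n IH]; first by rewrite !big_ord0 addn0 bin_small //; ring.
rewrite !big_ord_recr /= mulrDr IH addSn addnS binS natrD !exprS; ring.
Qed.

(** Induction on the exponent: division by 1+u >= 1 does not enlarge the error, and only the
    boundary term of [negative_binomial_sum] is added to the constant. *)
Lemma negative_binomial_taylor m n : exists2 A : R, 0 <= A &
  forall u, 0 <= u ->
  `|(1 + u) ^- m.+1 - \sum_(j < n) (-1) ^+ j * 'C(m + j, m)%:R * u ^+ j|
  <= A * u ^+ n.
Proof.
elim: m => [|m [A A0 IH]].
  exists 1 => // u u0; have u1 : 0 < 1 + u by lra.
  have ui : 0 <= (1 + u)^-1 by rewrite invr_ge0 ltW.
  rewrite (eq_bigr (fun j : 'I_n => (- u) ^+ j)); last first.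
    by move=> j _; rewrite bin0 mulr1 -exprNn.
  have -> : (1 + u) ^- 1 - \sum_(j < n) (- u) ^+ j = (- u) ^+ n / (1 + u).
    by rewrite -[X in _ - X](mulfK (lt0r_neq0 u1)) geom_altern; field; lra.
  rewrite normrM normrX normrN (ger0_norm u0) (ger0_norm ui).
  by rewrite mul1r ler_piMr ?exprn_ge0 // invf_le1 //; lra.
exists (A + 'C(m + n, m.+1)%:R); first by rewrite addr_ge0.
move=> u u0; have u1 : 0 < 1 + u by lra.
have ui : 0 <= (1 + u)^-1 by rewrite invr_ge0 ltW.
set S := \sum_(j < n) _.
have SE := negative_binomial_sum m n u; rewrite -/S in SE.
have -> : (1 + u) ^- m.+2 - S = ((1 + u) ^- m.+1
   - \sum_(j < n) (-1) ^+ j * 'C(m + j, m)%:R * u ^+ j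
   + (-1) ^+ n * 'C(m + n, m.+1)%:R * u ^+ n) / (1 + u).
  rewrite -[S](mulKf (lt0r_neq0 u1)) SE [in LHS]exprS invfM; ring.
rewrite normrM (ger0_norm ui).
apply: (@le_trans _ _ (A * u ^+ n + 'C(m + n, m.+1)%:R * u ^+ n)); last first.
  by rewrite mulrDl.
rewrite -[leRHS]mulr1; apply: ler_pM => //; last by rewrite invf_le1 //; lra.
apply: (le_trans (ler_normD _ _)); apply: lerD; first exact: IH.
rewrite !normrM normrX normrN1 expr1n mul1r !ger0_norm ?exprn_ge0 //.
Qed.

End ElementaryAnalysis.

(** * Wallis integrals and the central binomial coefficient *)

Section Wallis.
Variable R : realType.

(* The antiderivative of cos^n that vanishes at 0. *)
Fixpoint cos_primitive (n : nat) (x : R) : R :=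
  match n with
  | 0 => x
  | 1 => sin x
  | n'.+2 => n'.+2%:R^-1 *
     (cos x ^+ n'.+1 * sin x + n'.+1%:R * cos_primitive n' x)
  end.

Lemma is_derive_cos_primitive (n : nat) (x : R) :
  is_derive x 1 (cos_primitive n) (cos x ^+ n).
Proof.
suff [] : is_derive x 1 (cos_primitive n) (cos x ^+ n) /\
          is_derive x 1 (cos_primitive n.+1) (cos x ^+ n.+1) by [].
elim: n => [|n [IH IH1]].
  by split; [rewrite expr0; exact: is_derive_id|rewrite expr1; exact: is_derive_sin].
split => //.
have := is_derive_sin x; have := is_derive_cos x => dc ds.
have -> : cos_primitive n.+2 = n.+2%:R^-1 \*:
    (@cos R ^+ n.+1 * @sin R + n.+1%:R \*: cos_primitive n).
  by apply/funext => y; rewrite /= !fctE.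
have := is_deriveZ n.+2%:R^-1 (is_deriveD (is_deriveM (is_deriveX n.+1 dc) ds)
  (is_deriveZ n.+1%:R IH)).
move/is_derive_eq; apply.
have -> : cos x ^+ n.+2 = cos x ^+ n * cos x ^+ 2 by rewrite -exprD addn2.
rewrite !fctE /GRing.scale /=.
have n2 : n.+2%:R != 0 :> R by rewrite pnatr_eq0.
apply: (mulfI n2); rewrite mulVKf // exprS -[n.+2%:R]natr1 /=.
have := cos2Dsin2 x; move: (cos x) (sin x) (n.+1%:R : R) => c s m cs.
have -> : s * (m * c ^+ n * - s) = - (m * c ^+ n * (1 - c ^+ 2)).
  by rewrite -cs; ring.
ring.
Qed.

(** The Wallis integral of cos^n over [0, pi/2], as a value of the primitive. *)
Let w n := cos_primitive n (pi / 2).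

Let pi2_ge0 : 0 <= pi / 2 :> R.
Proof. by rewrite divr_ge0 // pi_ge0. Qed.

Let cos_primitive_at0 n : cos_primitive n 0 = 0.
Proof.
suff [] : cos_primitive n 0 = 0 /\ cos_primitive n.+1 0 = 0 by [].
elim: n => [|n [IH IH1]]; first by split; rewrite /= ?sin0.
by split => //; rewrite /= IH sin0 !mulr0 addr0 mulr0.
Qed.

Let w_rec n : w n.+2 = n.+1%:R / n.+2%:R * w n.
Proof. by rewrite /w /= cos_pihalf expr0n mul0r add0r; ring. Qed.

Let w_decr n : w n.+1 <= w n.
Proof.
have [x _|c /andP[c0 c1]] := @mvt_seg R (fun x => cos_primitive n x - cos_primitive n.+1 x)
  (fun x => cos x ^+ n - cos x ^+ n.+1) (pi / 2) pi2_ge0.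
  by apply: is_deriveB; exact: is_derive_cos_primitive.
rewrite !cos_primitive_at0 subrr subr0 => E.
rewrite -subr_ge0 /w E mulr_ge0 // exprSr -{1}[cos c ^+ n]mulr1 -mulrBr.
have c2 : 0 <= cos c.
  by apply: cos_ge0_pihalf; rewrite c1 andbT (le_trans _ c0) // oppr_le0.
by rewrite mulr_ge0 ?exprn_ge0 // subr_ge0 cos_le1.
Qed.

Let w_prod n : w n * w n.+1 * n.+1%:R = pi / 2.
Proof.
elim: n => [|n IH]; first by rewrite /w /= sin_pihalf !mulr1.
rewrite -IH w_rec -(natr1 n.+1) -(natr1 n).
have nn : 0 <= n%:R :> R by [].
by field; lra.
Qed.

(** This is 'C(2n, n) / 4^n. *)
Definition central (n : nat) : R := (2 * n)`!%:R / (4 ^+ n * n`!%:R ^+ 2).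

Let w_even n : w (2 * n) = central n * (pi / 2).
Proof.
elim: n => [|n IH]; first by rewrite /w /central /= expr0 expr1n muln0 mul1r divr1 mul1r.
rewrite mulnS add2n w_rec IH /central mulnS add2n 2!factS factS.
have nf : n`!%:R != 0 :> R by rewrite pnatr_eq0 -lt0n fact_gt0.
have n4 : 4 ^+ n != 0 :> R by rewrite expf_neq0.
move: ((2 * n)`!) (n`!) nf => a b nf; rewrite (exprS 4) !natrM.
rewrite -(natr1 (2 * n).+1) -(natr1 (2 * n)) -(natr1 n) natrM.
have nn : 0 <= n%:R :> R by [].
by field; rewrite nf n4 /=; lra.
Qed.

(** Monotonicity places w(2n)^2 between w(2n) w(2n+1) and w(2n-1) w(2n), and both products are known
    exactly from [w_prod]. *)
Lemma wallis_bounds n : (0 < n)%N ->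
  2 * n%:R / (2 * n%:R + 1) <= pi * n%:R * central n ^+ 2 <= 1.
Proof.
move=> n0; have nR : 0 < n%:R :> R by rewrite ltr0n.
have p0 := pi_gt0 R; set c := central n.
have c0 : 0 < c by rewrite divr_gt0 ?mulr_gt0 ?exprn_gt0 ?ltr0n ?fact_gt0.
have w0 : 0 < c * (pi / 2) by rewrite mulr_gt0 ?divr_gt0.
have we0 : 0 <= w (2 * n) by rewrite w_even ltW.
have n2 : (2 * n)%N = (2 * n).-1.+1 by rewrite prednK // muln_gt0.
have hi : w (2 * n) ^+ 2 * (2 * n)%:R <= pi / 2.
  rewrite -(w_prod (2 * n).-1) -n2 ler_wpM2r // expr2 ler_wpM2r //.
  by rewrite {1}n2 w_decr.
have lo : pi / 2 <= w (2 * n) ^+ 2 * (2 * n).+1%:R.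
  by rewrite -(w_prod (2 * n)) ler_wpM2r // expr2 ler_wpM2l.
move: lo hi; rewrite w_even -/c -(natr1 (2 * n)) natrM => lo hi.
apply/andP; split.
  rewrite ler_pdivrMr; last by lra.
  rewrite -(ler_pM2r p0); have := ler_wpM2r (ltW nR) lo; lra.
rewrite -(ler_pM2r p0); nra.
Qed.

End Wallis.

(** * The formal shifted Stirling series *)

Section StirlingExpansion.
Variable R : realType.
Implicit Types (h u x : R) (M m p : nat).

Definition stirling_coef m h : R :=
  (-1) ^+ m.+1 * bernoulli_poly m.+1 h / (m%:R * m.+1%:R).

(* Approximates ln Gamma(x + h), up to the constant ln (2 pi) / 2. *)
Definition stirling M h x : R :=
  (x + h - 2^-1) * ln x - x + \sum_(m < M) stirling_coef m.+1 h / x ^+ m.+1.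

(* The coefficient of u^(p+1), where u = 1/x, in the expansion of
   stirling h (x + 1) - stirling h x - ln (x + h). *)
Lemma stirling_coef_rec p h :
  (-1) ^+ p.+1 / p.+2%:R + (h + 2^-1) * ((-1) ^+ p / p.+1%:R)
  - (-1) ^+ p / p.+1%:R * h ^+ p.+1
  + \sum_(m < p) stirling_coef m.+1 h * ((-1) ^+ (p - m) * 'C(p, m)%:R) = 0.
Proof.
have p1 : p.+1%:R != 0 :> R by rewrite pnatr_eq0.
have p2 : p.+2%:R != 0 :> R by rewrite pnatr_eq0.
(* Since 'C(p, m) / ((m+1)(m+2)) = 'C(p+2, m+2) / ((p+1)(p+2)), the sum is the part j >= 2 of the
   Bernoulli recursion of order p+1; the terms j = 0 and j = 1 account for the rest. *)
rewrite (eq_bigr (fun m : 'I_p => (-1) ^+ p / (p.+1%:R * p.+2%:R) *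
   ('C(p.+2, m.+2)%:R * bernoulli_poly m.+2 h))); last first.
  move=> m _; rewrite /stirling_coef.
  have -> : (-1) ^+ p = (-1) ^+ m * (-1) ^+ (p - m) :> R.
    by rewrite -exprD subnKC // ltnW.
  have := mul_bin_diag p.+2 m.+1; have := mul_bin_diag p.+1 m => /= e1 e2.
  have E : 'C(p.+2, m.+2)%:R * m.+1%:R * m.+2%:R =
      p.+1%:R * p.+2%:R * 'C(p, m)%:R :> R.
    rewrite -!natrM; congr (_%:R); rewrite mulnAC (mulnC 'C(_, _)) -e2.
    by rewrite -mulnA (mulnC 'C(_, _)) -e1; lia.
  have m1 : m.+1%:R != 0 :> R by rewrite pnatr_eq0.
  have m2 : m.+2%:R != 0 :> R by rewrite pnatr_eq0.
  have -> : 'C(p, m)%:R = 'C(p.+2, m.+2)%:R * m.+1%:R * m.+2%:R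
      / (p.+1%:R * p.+2%:R) :> R by rewrite E [RHS]mulrC mulKf // mulf_neq0.
  have pn : 0 <= p%:R :> R by [].
  have mn : 0 <= m%:R :> R by [].
  clear e1 e2 E.
  by rewrite 2!exprS; field; repeat (apply/andP; split); lra.
rewrite -mulr_sumr.
have := bernoulli_poly_rec p.+1 h.
rewrite 2!big_ord_recl bernoulli_poly0 bernoulli_poly1 bin0 bin1 mulr1.
rewrite (eq_bigr (fun m : 'I_p => 'C(p.+2, m.+2)%:R * bernoulli_poly m.+2 h)) //.
move/eqP; rewrite addrA addrC eq_sym -subr_eq => /eqP <-.
have pn : 0 <= p%:R :> R by [].
by rewrite (exprS (-1)); field; repeat (apply/andP; split); lra.
Qed.

Definition log_poly (n : nat) u : R := \sum_(j < n) (-1) ^+ j / j.+1%:R * u ^+ j.+1.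

(** The Taylor polynomial in u = 1/x of the one-step difference; the first sum stands for x ln(1+u).
    All truncations stop at u^(M+1), so passing from M to M+1 adds u^(M+2) times the left side of
    [stirling_coef_rec] at p = M+1, which is 0. *)
Lemma stirling_step_poly M h u :
  \sum_(j < M.+2) (-1) ^+ j / j.+1%:R * u ^+ j + (h + 2^-1) * log_poly M.+1 u
  - 1 - log_poly M.+1 (h * u)
  + \sum_(m < M) stirling_coef m.+1 h * u ^+ m.+1 *
      (\sum_(j < M.+1 - m) (-1) ^+ j * 'C(m + j, m)%:R * u ^+ j - 1) = 0.
Proof.
rewrite /log_poly; pose F M := \sum_(j < M.+2) (-1) ^+ j / j.+1%:R * u ^+ j
  + (h + 2^-1) * (\sum_(j < M.+1) (-1) ^+ j / j.+1%:R * u ^+ j.+1)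
  - 1 - \sum_(j < M.+1) (-1) ^+ j / j.+1%:R * (h * u) ^+ j.+1
  + \sum_(m < M) stirling_coef m.+1 h * u ^+ m.+1 *
      (\sum_(j < M.+1 - m) (-1) ^+ j * 'C(m + j, m)%:R * u ^+ j - 1).
rewrite -[LHS]/(F M); elim: M => [|M IH].
  by rewrite /F !big_ord_recr !big_ord0 /=; field.
have := stirling_coef_rec M.+1 h; set K := (X in X = 0) => K0.
suff -> : F M.+1 = F M + u ^+ M.+2 * K by rewrite IH K0 mulr0 addr0.
have SE : \sum_(m < M) stirling_coef m.+1 h * u ^+ m.+1 *
      (\sum_(j < M.+2 - m) (-1) ^+ j * 'C(m + j, m)%:R * u ^+ j - 1) =
    \sum_(m < M) stirling_coef m.+1 h * u ^+ m.+1 *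
      (\sum_(j < M.+1 - m) (-1) ^+ j * 'C(m + j, m)%:R * u ^+ j - 1) +
    u ^+ M.+2 * \sum_(m < M) stirling_coef m.+1 h *
      ((-1) ^+ (M.+1 - m) * 'C(M.+1, m)%:R).
  rewrite mulr_sumr -big_split; apply: eq_bigr => m _ /=.
  have mM : (m <= M)%N by rewrite ltnW.
  rewrite (subSn (leqW mM)) big_ord_recr /= subnKC ?leqW //.
  rewrite (_ : u ^+ M.+2 = u ^+ m.+1 * u ^+ (M.+1 - m)); first by ring.
  by rewrite -exprD; congr (_ ^+ _); lia.
rewrite /F /K.
rewrite [\sum_(m < M.+1) stirling_coef _ _ * (u ^+ m.+1) * _]big_ord_recr /= SE.
rewrite [\sum_(m < M.+1) stirling_coef _ _ * _]big_ord_recr /= subSnn.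
rewrite (_ : (M.+2 - M = 2)%N); last by lia.
rewrite [\sum_(j < 2) _]big_ord_recr big_ord1 /= addn0 addn1 binn binSn.
rewrite [\sum_(j < M.+3) _]big_ord_recr /=.
rewrite [\sum_(j < M.+2) _ * u ^+ j.+1]big_ord_recr /=.
rewrite [\sum_(j < M.+2) _ * (h * u) ^+ j.+1]big_ord_recr /=.
rewrite (exprMn _ h) (exprS u M.+1) (exprS (-1) M.+1); ring.
Qed.

End StirlingExpansion.

(** * One-step error of the Stirling series and its summation *)

Section StirlingRemainder.
Variable R : realType.
Implicit Types (h u x y : R) (M m p q : nat).

Lemma stirling_coef_bounded m :
  exists2 D : R, 0 <= D & forall h, 0 <= h <= 1 -> `|stirling_coef m h| <= D.
Proof.
have [D HD] := bernoulli_poly_bounded R m.+1.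
have D0 : 0 <= D by apply: le_trans (HD 0 _); rewrite ?lexx ?ler01.
exists (D / (m%:R * m.+1%:R)); first by rewrite divr_ge0 // mulr_ge0.
move=> h h01; rewrite /stirling_coef normrM (normrM (_ ^+ _)).
rewrite normrX normrN1 expr1n mul1r.
have n0 : 0 <= (m%:R * m.+1%:R : R)^-1 by rewrite invr_ge0 mulr_ge0.
by rewrite (ger0_norm n0) ler_wpM2r // HD.
Qed.

Lemma stirling_step M : exists2 A : R, 0 <= A & forall h x, 0 <= h <= 1 ->
  1 <= x ->
  `|stirling M h (x + 1) - stirling M h x - ln (x + h)| <= A / x ^+ M.+2.
Proof.
have /choice[A HA] : forall m, exists A : R, 0 <= A /\ forall u, 0 <= u ->
    `|(1 + u) ^- m.+1
      - \sum_(j < M.+1 - m) (-1) ^+ j * 'C(m + j, m)%:R * u ^+ j|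
    <= A * u ^+ (M.+1 - m).
  by move=> m; have [A ? ?] := negative_binomial_taylor R m (M.+1 - m); exists A.
have /choice[D HD] : forall m, exists D : R, 0 <= D /\
    forall h, 0 <= h <= 1 -> `|stirling_coef m.+1 h| <= D.
  by move=> m; have [D ? ?] := stirling_coef_bounded m.+1; exists D.
(* The 4 is 1 + 2 + 1: x times the error of ln(1+u), then h + 1/2 <= 2 times such an error, then the
   error of ln(1+hu). The sum bounds the errors of the negative powers. *)
exists (4 + \sum_(m < M) D m * A m).
  rewrite addr_ge0 // sumr_ge0 // => m _.
  by rewrite mulr_ge0 //; [have [] := HD m|have [] := HA m].
move=> h x /andP[h0 h1] x1.
have x0 : 0 < x by lra.
have xn0 : x != 0 by rewrite gt_eqF.
pose u := x^-1; have u0 : 0 < u by rewrite invr_gt0.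
have u1 : u <= 1 by rewrite invf_le1.
have xu : x * u = 1 by rewrite mulfV.
have uM : 0 <= u ^+ M.+2 by rewrite exprn_ge0 // ltW.
have -> : (4 + \sum_(m < M) D m * A m) / x ^+ M.+2 =
    u ^+ M.+2 + 2 * u ^+ M.+2 + u ^+ M.+2
    + \sum_(m < M) D m * A m * u ^+ M.+2.
  by rewrite -mulr_suml /u exprVn; ring.
set l1 := ln (1 + u); set lh := ln (1 + h * u).
have hu0 : 0 <= h * u by rewrite mulr_ge0 // ltW.
have lx1 : ln (x + 1) = ln x + l1.
  by rewrite /l1 -lnM ?posrE //; [rewrite mulrDr mulr1 xu|lra].
have lxh : ln (x + h) = ln x + lh.
  rewrite /lh -lnM ?posrE //; last by lra.
  by rewrite mulrDr mulr1 mulrCA xu mulr1.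
pose P m := \sum_(j < M.+1 - m) (-1) ^+ j * 'C(m + j, m)%:R * u ^+ j.
have S1 : \sum_(m < M) stirling_coef m.+1 h / (x + 1) ^+ m.+1 =
    \sum_(m < M) stirling_coef m.+1 h / x ^+ m.+1 +
    (\sum_(m < M) stirling_coef m.+1 h * u ^+ m.+1 *
       ((1 + u) ^- m.+1 - P m) +
     \sum_(m < M) stirling_coef m.+1 h * u ^+ m.+1 * (P m - 1)).
  rewrite -!big_split; apply: eq_bigr => m _ /=.
  have -> : x + 1 = x * (1 + u) by rewrite mulrDr mulr1 xu.
  rewrite exprMn invfM -!exprVn -/u; ring.
have S0 := stirling_step_poly M h u.
have S2 : \sum_(j < M.+2) (-1) ^+ j / j.+1%:R * u ^+ j = x * log_poly M.+2 u.
  rewrite /log_poly mulr_sumr; apply: eq_bigr => j _.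
  by rewrite exprS mulrCA (mulrA x) xu mul1r.
rewrite S2 in S0.
(* Subtracting the vanishing polynomial [S0] leaves nothing but Taylor remainders. *)
have -> : stirling M h (x + 1) - stirling M h x - ln (x + h) =
    x * (l1 - log_poly M.+2 u) + (h + 2^-1) * (l1 - log_poly M.+1 u)
    - (lh - log_poly M.+1 (h * u))
    + \sum_(m < M) stirling_coef m.+1 h * u ^+ m.+1 *
       ((1 + u) ^- m.+1 - P m).
  rewrite /stirling lx1 lxh S1.
  set T1 := \sum_(m < M) _ / _.
  set T2 := \sum_(m < M) _ * (_ - P m).
  set T3 := \sum_(m < M) _ * (P m - 1).
  have {}S0 : x * log_poly M.+2 u + (h + 2^-1) * log_poly M.+1 u - 1
    - log_poly M.+1 (h * u) + T3 = 0 by [].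
  move: (log_poly _ _) (log_poly _ _) (log_poly _ _) T1 T2 T3 S0.
  move=> L1 L2 L3 T1 T2 T3 S0.
  apply/eqP; rewrite -subr_eq0 -[X in _ == X]S0; by apply/eqP; field.
apply: (le_trans (ler_normD _ _)); apply: lerD.
  apply: (le_trans (ler_normB _ _)); apply: lerD.
    apply: (le_trans (ler_normD _ _)); apply: lerD.
      rewrite normrM ger0_norm ?(ltW x0) //.
      have := ler_wpM2l (ltW x0) (ln1D_taylor M.+2 (ltW u0)).
      by rewrite (exprS u M.+2) mulrA xu mul1r.
    have hh : 0 <= h + 2^-1 by lra.
    have hh2 : h + 2^-1 <= 2 by lra.
    rewrite normrM (ger0_norm hh); apply: ler_pM => //.
    exact: (ln1D_taylor M.+1 (ltW u0)).
  apply: (le_trans (ln1D_taylor M.+1 hu0)).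
  rewrite exprMn ler_piMl // exprn_ile1 //.
apply: (le_trans (ler_norm_sum _ _ _)); apply: ler_sum => m _.
have mM : (m < M)%N by [].
have -> : u ^+ M.+2 = u ^+ m.+1 * u ^+ (M.+1 - m).
  by rewrite -exprD; congr (_ ^+ _); lia.
have [A0 HAm] := HA m; have [D0 HDm] := HD m.
have um : 0 <= u ^+ m.+1 by rewrite exprn_ge0 // ltW.
rewrite normrM (normrM (stirling_coef _ _)) (ger0_norm um).
have -> : D m * A m * (u ^+ m.+1 * u ^+ (M.+1 - m)) =
    (D m * u ^+ m.+1) * (A m * u ^+ (M.+1 - m)) by ring.
apply: ler_pM => //; first by rewrite mulr_ge0.
  by rewrite ler_wpM2r // HDm // h0.
by apply: HAm; exact: ltW.
Qed.

(** Makes errors of order y^-(p+2) summable by telescoping, with total of order y^-(p+1). Bounding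
    (y+1)^-(p+1) by y^-p / (y+1) reduces it to 1/y <= 2/(y+1), true for y >= 1. *)
Lemma inv_pow_diff p y : 1 <= y ->
  (y ^+ p.+2)^-1 <= 2 * ((y ^+ p.+1)^-1 - ((y + 1) ^+ p.+1)^-1).
Proof.
move=> y1; have y0 : 0 < y by lra.
have yn : y != 0 by rewrite gt_eqF.
have y1n : y + 1 != 0 by rewrite gt_eqF //; lra.
have H : ((y + 1) ^+ p.+1)^-1 <= y^-1 ^+ p * (y + 1)^-1.
  rewrite exprSr invfM ler_wpM2r ?invr_ge0 //; first by lra.
  rewrite exprVn lef_pV2 ?posrE ?exprn_gt0 //; last by lra.
  by rewrite lerXn2r ?nnegrE //; lra.
rewrite -!exprVn.
apply: (@le_trans _ _ (2 * (y^-1 ^+ p.+1 - y^-1 ^+ p * (y + 1)^-1))); last first.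
  by rewrite ler_wpM2l // lerB // exprVn.
have -> : y^-1 ^+ p.+2 = y^-1 ^+ p * (y^-1 * y^-1) by rewrite !exprSr mulrA.
have -> : 2 * (y^-1 ^+ p.+1 - y^-1 ^+ p * (y + 1)^-1) =
    y^-1 ^+ p * (2 * (y^-1 - (y + 1)^-1)) by rewrite exprSr; ring.
rewrite ler_wpM2l ?exprn_ge0 ?invr_ge0 ?(ltW y0) //.
have -> : 2 * (y^-1 - (y + 1)^-1) = y^-1 * (2 / (y + 1)) by field; rewrite yn y1n.
rewrite ler_wpM2l ?invr_ge0 ?(ltW y0) // ler_pdivlMr; last by lra.
by rewrite ler_pdivrMl //; lra.
Qed.

Lemma telescope_bound p (A x : R) (f : nat -> R) : 1 <= x -> 0 <= A ->
  (forall k, `|f k.+1 - f k| <= A / (x + k%:R) ^+ p.+2) ->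
  forall k, `|f k - f 0%N| <= 2 * A / x ^+ p.+1.
Proof.
move=> x1 A0 Hf k.
suff H : `|f k - f 0%N| <= 2 * A * ((x ^+ p.+1)^-1 - ((x + k%:R) ^+ p.+1)^-1).
  apply: (le_trans H); rewrite ler_wpM2l ?mulr_ge0 // gerBl invr_ge0.
  by rewrite exprn_ge0 // addr_ge0 //; lra.
elim: k => [|k IH]; first by rewrite subrr normr0 addr0 subrr mulr0.
have -> : f k.+1 - f 0%N = (f k.+1 - f k) + (f k - f 0%N) by ring.
apply: (le_trans (ler_normD _ _)); apply: (le_trans (lerD (Hf k) IH)).
have yk : 1 <= x + k%:R by rewrite (le_trans x1) // lerDl.
have := ler_wpM2l A0 (inv_pow_diff p yk).
rewrite -(natr1 k) addrA; lra.
Qed.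

End StirlingRemainder.

(** * The additive constant of the Stirling series *)

Section StirlingConstant.
Variable R : realType.
Implicit Types (h x y : R) (M n q k : nat).

(** A passage to the limit n -> infinity in which [D] may depend on all other data. *)
Lemma le_of_inv_nat (a b D : R) n0 :
  (forall n, (n0 <= n)%N -> a <= b + D / n%:R) -> a <= b.
Proof.
move=> H; apply/ler_addgt0Pr => e e0.
pose n := maxn n0 (Num.bound (`|D| / e)).+1.
apply: (le_trans (H n (leq_maxl _ _))); rewrite lerD2l.
have n1 : (0 < n)%N by rewrite /n; lia.
rewrite ler_pdivrMr ?ltr0n // mulrC -ler_pdivrMr //.
have b0 : 0 <= `|D| / e by rewrite divr_ge0 // ltW.
apply: (@le_trans _ _ (`|D| / e)).
  by rewrite ler_wpM2r ?ler_norm // invr_ge0 ltW.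
apply: (le_trans (ltW (archi_boundP b0))).
by rewrite ler_nat /n; lia.
Qed.

(** Both sides come from ln(1+x) <= x, at x = -y and at x = y/(1-y), where 1+x = 1/(1-y). *)
Lemma ln1B_bounds y : 0 <= y <= 2^-1 ->
  - y - 2 * y ^+ 2 <= ln (1 - y) <= - y.
Proof.
move=> /andP[y0 y1]; have y2 : 0 < 1 - y by lra.
apply/andP; split; last by apply: le_ln1Dx; lra.
have H := @le_ln1Dx R (y / (1 - y)) _.
have E : 1 + y / (1 - y) = (1 - y)^-1 by field; lra.
rewrite E lnV ?posrE // in H.
have y3 : 0 <= y / (1 - y) by rewrite divr_ge0 // ltW.
have {}H := H (lt_le_trans (ltrN10 R) y3).
suff : y / (1 - y) <= y + 2 * y ^+ 2 by lra.
by rewrite ler_pdivrMr //; nra.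
Qed.

Lemma ln_central_bound n : (0 < n)%N ->
  `|2 * ln (central R n) + ln n%:R + ln pi| <= n%:R^-1.
Proof.
move=> n0; have nR : 0 < n%:R :> R by rewrite ltr0n.
have p0 := pi_gt0 R.
have c0 : 0 < central R n.
  by rewrite divr_gt0 ?mulr_gt0 ?exprn_gt0 ?ltr0n ?fact_gt0.
have /andP[lo hi] := wallis_bounds R n0.
have E : 2 * ln (central R n) + ln n%:R + ln pi =
    ln (pi * n%:R * central R n ^+ 2).
  rewrite lnM ?posrE ?mulr_gt0 ?exprn_gt0 // lnM ?posrE // lnXn // mulr_natl.
  ring.
have q0 : 0 < pi * n%:R * central R n ^+ 2 by rewrite ?mulr_gt0 ?exprn_gt0.
rewrite E ler_norml; apply/andP; split; last first.
  by apply: (le_trans (ln_le0 hi)); rewrite invr_ge0 ltW.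
have d0 : 0 < 2 * n%:R / (2 * n%:R + 1) :> R by rewrite divr_gt0 //; lra.
apply: (le_trans _ (_ : ln (2 * n%:R / (2 * n%:R + 1)) <= _)); last first.
  by rewrite ler_ln.
rewrite -[X in ln X]invrK lnV ?posrE ?invr_gt0 // lerN2.
have -> : (2 * n%:R / (2 * n%:R + 1))^-1 = 1 + (2 * n%:R)^-1 :> R.
  by field; lra.
have i0 : 0 < (2 * n%:R)^-1 :> R by rewrite invr_gt0; lra.
apply: (le_trans (le_ln1Dx _)); first by lra.
by rewrite lef_pV2 ?posrE //; lra.
Qed.

(** The factorial is Gamma(x+h) at x = q - h; the limit in q will be ln(2 pi) / 2 for every h. *)
Definition stirling_rem M h q : R :=
  ln ((q.-1)`!%:R) - stirling M h (q%:R - h).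

Lemma fact_pred n : (0 < n)%N -> n`! = (n * n.-1`!)%N.
Proof. by case: n => // n _; rewrite factS. Qed.

(** Up to sign, each increment in q is the one-step error at x = q - h + j. The condition q >= 2
    keeps x >= 1 even when h = 1. *)
Lemma stirling_rem_diff M : exists2 A : R, 0 <= A & forall h q k,
  0 <= h <= 1 -> (2 <= q)%N ->
  `|stirling_rem M h (q + k) - stirling_rem M h q|
  <= A / (q%:R - h) ^+ M.+1.
Proof.
have [A A0 HA] := stirling_step R M.
exists (2 * A); first by rewrite mulr_ge0.
move=> h q k h01 q2; have /andP[h0 h1] := h01.
have q2R : 2 <= q%:R :> R by rewrite ler_nat.
have x1 : 1 <= q%:R - h by lra.
rewrite -[q in X in _ - X]addn0.
apply: (telescope_bound (f := fun k => stirling_rem M h (q + k))) => // j.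
have j0 : 0 <= j%:R :> R by [].
have x2 : 1 <= q%:R - h + j%:R by lra.
rewrite distrC; have := HA h (q%:R - h + j%:R) h01 x2.
have -> : q%:R - h + j%:R + 1 = (q + j.+1)%:R - h :> R.
  by rewrite natrD -(natr1 j); ring.
have -> : q%:R - h + j%:R + h = (q + j)%:R :> R by rewrite natrD; ring.
have -> : q%:R - h + j%:R = (q + j)%:R - h :> R by rewrite natrD; ring.
rewrite /stirling_rem addnS -pred_Sn.
have -> : (q + j)%N = (q + j).-1.+1 by rewrite prednK //; lia.
move: ((q + j).-1) => r; rewrite -pred_Sn factS (natrM _ r.+1).
rewrite lnM ?posrE ?ltr0n ?fact_gt0 //.
set a := stirling _ _ _; set b := stirling _ _ _.
by congr (`|_| <= _); ring.
Qed.

Let coef_sum M h x : R := \sum_(m < M) stirling_coef m.+1 h / x ^+ m.+1.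

Let coef_sum_bound M h x : 1 <= x ->
  `|coef_sum M h x| <= (\sum_(m < M) `|stirling_coef m.+1 h|) / x.
Proof.
move=> x1; apply: (le_trans (ler_norm_sum _ _ _)); rewrite mulr_suml.
apply: ler_sum => m _; rewrite normrM ler_wpM2l //.
have x0 : 0 < x by lra.
rewrite ger0_norm ?invr_ge0 ?exprn_ge0 ?(ltW x0) //.
rewrite lef_pV2 ?posrE ?exprn_gt0 // exprS ler_peMr ?(ltW x0) //.
by rewrite exprn_ege1.
Qed.

(** The factorials in 2 r(n) - r(2n) are those of ln([central] n), so Wallis evaluates the
    combination. Here [D] depends on h, which [stirling_shifted] absorbs. *)
Lemma stirling_rem_limit M h : 0 <= h <= 1 -> exists D : R, forall n,
  (2 <= n)%N ->
  `|2 * stirling_rem M h n - stirling_rem M h (2 * n) - ln (2 * pi) / 2|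
  <= D / n%:R.
Proof.
move=> /andP[h0 h1]; pose B : R := \sum_(m < M) `|stirling_coef m.+1 h|.
have B0 : 0 <= B by apply: sumr_ge0.
(* The inverse powers contribute 2 (2 B) + B; the other 5 covers Wallis' error and the estimates of
   ln(1-y) and ln(1-y/2). *)
exists (5 + 5 * B) => n n2.
have n2R : 2 <= n%:R :> R by rewrite ler_nat.
have n1 : (0 < n)%N by lia.
have n3 : (0 < 2 * n)%N by lia.
have nn0 : n%:R != 0 :> R by rewrite pnatr_eq0 -lt0n.
have ip : 0 < n%:R^-1 :> R by rewrite invr_gt0; lra.
pose y := h / n%:R; have hy : h = n%:R * y by rewrite /y mulrC divfK.
have y0 : 0 <= y by rewrite /y divr_ge0.
have yi : y <= n%:R^-1 by rewrite /y ler_piMl // ltW.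
have i2 : n%:R^-1 <= 2^-1 :> R by rewrite lef_pV2 ?posrE //; lra.
set s1 := ln (1 - y); set s2 := ln (1 - y / 2).
have /andP[s1l s1u] : - y - 2 * y ^+ 2 <= s1 <= - y by apply: ln1B_bounds; lra.
have /andP[s2l s2u] : - (y / 2) - 2 * (y / 2) ^+ 2 <= s2 <= - (y / 2).
  by apply: ln1B_bounds; lra.
have E1 : ln (n%:R - h) = ln n%:R + s1.
  rewrite /s1 -lnM ?posrE; first by rewrite hy; congr ln; ring.
    lra.
  lra.
have E2 : ln ((2 * n)%:R - h) = ln 2 + ln n%:R + s2.
  rewrite /s2 -!lnM ?posrE; try lra.
  by rewrite natrM hy; congr ln; field.
have r4 : ln 4 = 2 * ln 2 :> R.
  by rewrite (_ : 4 = 2 * 2) ?lnM ?posrE //; ring.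
have E3 : ln (central R n) = ln ((2 * n).-1`!%:R) + ln 2 + ln n%:R
    - (2 * n%:R * ln 2 + 2 * (ln (n.-1`!%:R) + ln n%:R)).
  rewrite /central ln_div ?posrE ?mulr_gt0 ?exprn_gt0 ?ltr0n ?fact_gt0 //.
  rewrite lnM ?posrE ?exprn_gt0 ?ltr0n ?fact_gt0 //.
  rewrite !lnXn ?ltr0n ?fact_gt0 // r4.
  rewrite (fact_pred n1) (fact_pred n3) -mulnA.
  rewrite (natrM _ 2) (natrM _ n) (natrM _ n).
  have f1 : 0 < (2 * n).-1`!%:R :> R by rewrite ltr0n fact_gt0.
  have f2 : 0 < n.-1`!%:R :> R by rewrite ltr0n fact_gt0.
  have nR : 0 < n%:R :> R by lra.
  by rewrite !lnM ?posrE ?mulr_gt0 //; ring.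
have := ln_central_bound n1; rewrite E3.
rewrite lnM ?posrE ?pi_gt0 // /stirling_rem /stirling E1 E2.
rewrite -!/(coef_sum _ _ _).
have := @coef_sum_bound M h (n%:R - h).
have := @coef_sum_bound M h ((2 * n)%:R - h).
rewrite -/B => C2 C1; have {}C1 := C1 ltac:(lra).
have {}C2 : `|coef_sum M h ((2 * n)%:R - h)| <= B / n%:R.
  have nR : n%:R <= (2 * n)%:R - h by rewrite natrM; lra.
  apply: (le_trans (C2 _)); first by lra.
  by rewrite ler_wpM2l // lef_pV2 ?posrE //; lra.
have {}C1 : `|coef_sum M h (n%:R - h)| <= 2 * B / n%:R.
  apply: (le_trans C1); rewrite [2 * B]mulrC -mulrA ler_wpM2l //.
  rewrite ler_pdivlMr; last by lra.
  by rewrite mulrC ler_pdivrMr; lra.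
move: C1 C2; move: (coef_sum M h _) (coef_sum M h _) => c1 c2.
move: (ln (n.-1`!%:R)) (ln ((2 * n).-1`!%:R)) => g1 g2.
rewrite (natrM _ 2).
have Y1 : (2 * n%:R - 1) * s1 <= - (2 * n%:R - 1) * y.
  by rewrite mulNr -mulrN ler_wpM2l //; lra.
have Y2 : - (2 * n%:R - 1) * (y + 2 * y ^+ 2) <= (2 * n%:R - 1) * s1.
  by rewrite mulNr -mulrN ler_wpM2l //; lra.
have Y3 : (2 * n%:R - 2^-1) * s2 <= - (2 * n%:R - 2^-1) * (y / 2).
  by rewrite mulNr -mulrN ler_wpM2l //; lra.
have Y4 : - (2 * n%:R - 2^-1) * (y / 2 + 2 * (y / 2) ^+ 2)
    <= (2 * n%:R - 2^-1) * s2.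
  by rewrite mulNr -mulrN ler_wpM2l //; lra.
have Y5 : n%:R * y ^+ 2 <= n%:R^-1.
  rewrite expr2 mulrA -hy; apply: le_trans yi; exact: ler_piMl.
have Y6 : 0 <= y ^+ 2 by rewrite exprn_ge0.
have -> : (5 + 5 * B) / n%:R = 5 * n%:R^-1 + 5 * (B / n%:R) by ring.
rewrite -[2 * B / _]mulrA.
move: (B / _) Y1 Y2 Y3 Y4 Y5 Y6; rewrite hy; move: (n%:R^-1 : R) ip yi i2.
clear -y0; move=> i i0 yi i2 b Y1 Y2 Y3 Y4 Y5 Y6 C1 C2.
move: (ln 2) (ln n%:R) (ln pi) => l2 ln lp.
move: (n%:R : R) (y : R) s1 s2 y0 yi Y1 Y2 Y3 Y4 Y5 Y6.
move=> m z t1 t2 y0 yi Y1 Y2 Y3 Y4 Y5 Y6.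
move: C1 C2; rewrite !ler_norml => /andP[C1 C1'] /andP[C2 C2'] /andP[C3 C3'].
by apply/andP; split; lra.
Qed.

(** Write r(n) = (2 r(n) - r(2n)) + (r(2n) - r(n)) and let n grow: all that survives is the distance
    from r(q) to r(n), whose bound is uniform in h. The interval for h is closed because 1 - h is
    used as well. *)
Lemma stirling_shifted M : exists2 A : R, 0 <= A & forall h q,
  0 <= h <= 1 -> (2 <= q)%N ->
  `|ln ((q.-1)`!%:R) - stirling M h (q%:R - h) - ln (2 * pi) / 2|
  <= A / (q%:R - h) ^+ M.+1.
Proof.
have [A A0 HA] := stirling_rem_diff M.
exists A => // h q h01 q2; rewrite -/(stirling_rem M h q).
have [D HD] := stirling_rem_limit M h01.
have /andP[h0 h1] := h01.
apply: (@le_of_inv_nat _ _ (D + 2 * A) q) => n qn.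
have n2 : (2 <= n)%N by exact: leq_trans qn.
have := HA h q (n - q)%N h01 q2; have := HA h n n h01 n2; have := HD n n2.
rewrite subnKC // addnn -mul2n.
have n2R : 2 <= n%:R :> R by rewrite ler_nat.
have : A / (n%:R - h) ^+ M.+1 <= 2 * A / n%:R.
  rewrite [2 * A]mulrC -mulrA ler_wpM2l //.
  rewrite ler_pdivlMr ?ltr0n //; last by lia.
  rewrite mulrC ler_pdivrMr ?exprn_gt0 //; last by lra.
  rewrite exprS; have := @exprn_ege1 R M (n%:R - h); move=> /(_ ltac:(lra)) e1.
  nra.
move: (_ / (n%:R - h) ^+ _) (A / (q%:R - h) ^+ _) => B1 B2.
move: (stirling_rem _ _ n) (stirling_rem _ _ (2 * n)) (stirling_rem _ _ q).
rewrite (mulrDl D); move: (ln _ / 2) => l x y z.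
rewrite !ler_norml; lra.
Qed.

End StirlingConstant.

(** * Exponentiating a truncated expansion *)

Section ExponentialExpansion.
Variable R : realType.
Implicit Types (B t : R) (a : nat -> R) (M m : nat).

Lemma exp_coef_bounded M B : 0 <= B -> exists2 D : R, 0 <= D &
  forall a, (forall k, (0 < k <= M)%N -> `|a k| <= B) ->
  forall m, (m <= M)%N -> `|exp_coef a m| <= D.
Proof.
move=> B0.
suff H j : (j <= M)%N -> exists2 D : R, 0 <= D &
    forall a, (forall k, (0 < k <= M)%N -> `|a k| <= B) ->
    forall m, (m <= j)%N -> `|exp_coef a m| <= D by exact: H.
elim: j => [_|j IH jM].
  by exists 1 => // a _ m; rewrite leqn0 => /eqP ->; rewrite exp_coef0 normr1.
have [D D0 HD] := IH (ltnW jM).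
have jB : 0 <= j.+1%:R * B :> R by rewrite mulr_ge0.
exists (D + j.+1%:R * B * D); first by rewrite addr_ge0 // mulr_ge0.
move=> a Ba m; rewrite leq_eqVlt => /predU1P[->|]; last first.
  by rewrite ltnS => /HD H; rewrite (le_trans (H a Ba)) // lerDl mulr_ge0.
rewrite exp_coefS // normrM normfV normr_nat.
rewrite ler_pdivrMl ?ltr0n //.
apply: (le_trans (ler_norm_sum _ _ _)).
apply: (@le_trans _ _ (\sum_(1 <= k < j.+2) j.+1%:R * (B * D))).
  rewrite big_nat_cond [leRHS]big_nat_cond; apply: ler_sum => k /andP[/andP[k1 k2] _].
  rewrite -mulrA normrM normr_nat normrM.
  apply: ler_pM => //; first by rewrite ler_nat; lia.
  apply: ler_pM => //; first by apply: Ba; lia.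
  by apply: HD => //; lia.
rewrite sumr_const_nat subn1 /= -[leLHS]mulr_natl.
have : 0 <= j.+1%:R * D by rewrite mulr_ge0.
by move: (j.+1%:R : R) => c cD; nra.
Qed.

(** With P the truncated exponent and G the truncated sum, the recursion kills the coefficients of q
    = G' - P' G below degree M. Hence G exp(-P), equal to 1 at 0, has derivative q exp(-P) = O(t^M),
    and the mean value theorem applies. *)
Lemma exp_coef_expansion M B : 0 <= B -> exists2 C : R, 0 <= C &
  forall a, (forall k, (0 < k <= M)%N -> `|a k| <= B) ->
  forall t, 0 <= t <= 1 ->
  `|\sum_(m < M.+1) exp_coef a m * t ^+ m
    - expR (\sum_(m < M) a m.+1 * t ^+ m.+1)| <= C * t ^+ M.+1.
Proof.
move=> B0; have [D D0 HD] := exp_coef_bounded M B0.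
(* q has degree at most 2M and i-th coefficient at most (i+1) M B D. In the final constant one
   factor [E] bounds exp(-P), the other exp(P). *)
pose Q : R := \sum_(i < M.*2.+1) i.+1%:R * (M%:R * B * D).
have Q0 : 0 <= Q by apply: sumr_ge0 => i _; rewrite !mulr_ge0.
pose E := expR (M%:R * B); have E0 : 0 < E := expR_gt0 _.
exists (E * (Q * E)); first by rewrite !mulr_ge0 // ltW.
move=> a Ba t /andP[t0 t1].
pose P : {poly R} := \sum_(m < M) a m.+1 *: 'X^(m.+1).
pose G : {poly R} := \poly_(m < M.+1) exp_coef a m.
have PE x : P.[x] = \sum_(m < M) a m.+1 * x ^+ m.+1.
  by rewrite horner_sum; apply: eq_bigr => m _; rewrite hornerZ hornerXn.
have GE x : G.[x] = \sum_(m < M.+1) exp_coef a m * x ^+ m by rewrite horner_poly.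
have P'E i : P^`()`_i = if (i < M)%N then i.+1%:R * a i.+1 else 0.
  rewrite coef_deriv coef_sum (eq_bigr (fun m : 'I_M =>
    if m == i :> nat then a i.+1 else 0)); last first.
    move=> m _; rewrite coefZ coefXn eqSS eq_sym.
    by case: eqP => [->|_]; rewrite ?mulr1 ?mulr0.
  rewrite -big_mkcond /=; case: ltnP => iM.
    rewrite (bigD1 (Ordinal iM)) //= big1 ?addr0 ?mulr_natl // => m.
    by rewrite -val_eqE /= => /andP[-> //].
  rewrite big1 ?mul0rn // => m /eqP mi.
  by have := ltn_ord m; rewrite mi ltnNge iM.
have GC i : G`_i = if (i < M.+1)%N then exp_coef a i else 0 by rewrite coef_poly.
have PB (x : R) : 0 <= x <= 1 -> `|P.[x]| <= M%:R * B.
  move=> /andP[x0 x1]; rewrite PE (le_trans (ler_norm_sum _ _ _)) //.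
  have -> : M%:R * B = \sum_(m < M) B by rewrite sumr_const card_ord mulr_natl.
  apply: ler_sum => m _; rewrite normrM normrX (ger0_norm x0) -[leRHS]mulr1.
  by apply: ler_pM; rewrite ?exprn_ge0 ?exprn_ile1 // Ba /=.
pose q := G^`() - P^`() * G.
have q_low i : (i < M)%N -> q`_i = 0.
  move=> iM; rewrite coefB coef_deriv GC ltnS iM coefM.
  have e : i.+1%:R * exp_coef a i.+1 =
      \sum_(k < i.+1) k.+1%:R * a k.+1 * exp_coef a (i.+1 - k.+1).
    by rewrite exp_coefS // mulVKf ?pnatr_eq0 // big_add1 big_mkord.
  rewrite -mulr_natl e; apply/eqP; rewrite subr_eq0; apply/eqP.
  apply: eq_bigr => k _; have ki : (k < i.+1)%N by [].
  rewrite P'E GC ifT; last by lia.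
  by rewrite ifT //; lia.
have q_high i : (M <= i)%N -> `|q`_i| <= i.+1%:R * (M%:R * B * D).
  move=> Mi; rewrite coefB coef_deriv GC ltnS ltnNge Mi /= mul0rn sub0r normrN.
  rewrite coefM (le_trans (ler_norm_sum _ _ _)) //.
  have -> : i.+1%:R * (M%:R * B * D) = \sum_(k < i.+1) M%:R * B * D.
    by rewrite sumr_const card_ord mulr_natl.
  apply: ler_sum => k _; rewrite P'E GC normrM.
  case: ifP => [kM|_]; last by rewrite normr0 mul0r !mulr_ge0.
  apply: ler_pM => //.
    rewrite normrM normr_nat; apply: ler_pM => //; first by rewrite ler_nat.
    by apply: Ba.
  by case: ifP => [ik|_]; [apply: HD|rewrite normr0].
have sq : (size q <= M.*2.+1)%N.
  have sG : (size G <= M.+1)%N by apply: size_poly.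
  have sG' : (size G^`() <= M)%N.
    apply/leq_sizeP => j Mj; rewrite coef_deriv GC ltnS ltnNge Mj /= mul0rn //.
  have sP' : (size P^`() <= M)%N.
    by apply/leq_sizeP => j Mj; rewrite P'E ltnNge Mj.
  apply: leq_trans (size_polyD _ _) _; rewrite geq_max size_polyN.
  apply/andP; split; first by rewrite -addnn; lia.
  apply: leq_trans (size_polyMleq _ _) _; rewrite -addnn.
  move: (size G) (size P^`()) sG sP' => x y sG sP'; lia.
have qB (x : R) : 0 <= x <= 1 -> `|q.[x]| <= Q * x ^+ M.
  move=> /andP[x0 x1]; rewrite (horner_coef_wide x sq).
  rewrite (le_trans (ler_norm_sum _ _ _)) // /Q mulr_suml; apply: ler_sum => i _.
  rewrite normrM normrX (ger0_norm x0).
  have [Mi|iM] := leqP M i; last first.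
    by rewrite q_low // normr0 mul0r !mulr_ge0 ?exprn_ge0.
  apply: ler_pM; rewrite ?exprn_ge0 ?q_high //.
  by rewrite -(subnKC Mi) exprD ler_piMr ?exprn_ge0 ?exprn_ile1.
pose phi x := G.[x] * expR (- P.[x]).
have dphi (x : R) : is_derive x 1 phi (q.[x] * expR (- P.[x])).
  have dN : is_derive x 1 (fun x : R => - P.[x]) (- P^`().[x]).
    by apply: is_deriveN; exact: is_derive_poly.
  have dE := @is_derive1_comp _ (@expR R) (fun y => - P.[y]) x _ _
    (is_derive_expR (- P.[x])) dN.
  have := is_deriveM (is_derive_poly G x) dE.
  move/is_derive_eq; apply; rewrite /GRing.scale /= /q hornerD hornerN hornerM.
  ring.
have Et (x : R) : 0 <= x <= 1 -> expR (P.[x]) <= E /\ expR (- P.[x]) <= E.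
  by move=> /PB; rewrite ler_norml => /andP[l1 l2]; split; rewrite ler_expR //; lra.
have := @mvt_norm_le R phi _ t (Q * t ^+ M * E) t0 (fun x _ => dphi x).
have -> : phi 0 = 1.
  rewrite /phi GE PE big_ord_recl exp_coef0 mul1r expr0.
  rewrite big1; last by move=> i _; rewrite expr0n mulr0.
  rewrite big1; last by move=> i _; rewrite expr0n mulr0.
  by rewrite addr0 oppr0 expR0 mulr1.
have H (x : R) : 0 <= x <= t -> `|q.[x] * expR (- P.[x])| <= Q * t ^+ M * E.
  move=> /andP[x0 xt]; have x01 : 0 <= x <= 1 by rewrite x0 (le_trans xt).
  rewrite normrM (ger0_norm (expR_ge0 _)); apply: ler_pM => //.
  - apply: (le_trans (qB x x01)); rewrite ler_wpM2l //.
    by rewrite lerXn2r ?nnegrE.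
  - by have [] := Et x x01.
move=> /(_ H) F; rewrite -GE -PE.
have -> : G.[t] - expR P.[t] = expR P.[t] * (phi t - 1).
  by rewrite /phi mulrBr mulr1 mulrCA -expRD subrr expR0 mulr1.
rewrite normrM (ger0_norm (expR_ge0 _)).
have -> : E * (Q * E) * t ^+ M.+1 = E * (Q * t ^+ M * E * t).
  by rewrite exprSr; ring.
apply: ler_pM => //.
by have [] := Et t; rewrite ?t0.
Qed.

Lemma expRB1_norm (z : R) : `|expR z - 1| <= `|z| * expR `|z|.
Proof.
have e0 := expR_gt0 z; have h1 := expR_ge1Dx (- z); have h2 := expR_ge1Dx z.
rewrite expRN in h1.
have h3 : expR z - 1 <= z * expR z.
  by have := ler_wpM2r (ltW e0) h1; rewrite mulVf ?gt_eqF //; lra.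
have h4 : 1 <= expR `|z| by rewrite -expR0 ler_expR.
have [z0|z0] := leP 0 z.
  by rewrite (ger0_norm z0) ger0_norm; lra.
rewrite (ltr0_norm z0) in h4 *; rewrite ler0_norm; last by rewrite subr_le0 expR_le1 ltW.
have -> : - (expR z - 1) = 1 - expR z by ring.
apply: (@le_trans _ _ (- z)); first by lra.
by rewrite ler_peMr //; lra.
Qed.

(** The constant depends on the bounds [B] and [C1] but not on the sequence [a], which is how
    uniformity in kappa, eta and h survives the exponential. *)
Lemma expR_asymptotic M B C1 : 0 <= B -> 0 <= C1 -> exists2 C : R, 0 <= C &
  forall a, (forall k, (0 < k <= M)%N -> `|a k| <= B) ->
  forall t A, 0 <= t <= 1 ->
  `|A - \sum_(m < M) a m.+1 * t ^+ m.+1| <= C1 * t ^+ M.+1 ->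
  `|expR A - \sum_(m < M.+1) exp_coef a m * t ^+ m| <= C * t ^+ M.+1.
Proof.
move=> B0 C10; have [C C0 HC] := exp_coef_expansion M B0.
pose E := expR (M%:R * B); have E0 : 0 < E := expR_gt0 _.
exists (E * (C1 * expR C1) + C).
  by rewrite addr_ge0 // !mulr_ge0 ?expR_ge0 // ltW.
move=> a Ba t A /andP[t0 t1]; set P := \sum_(m < M) _ => HA.
have := HC a Ba t; rewrite t0 t1 -/P => /(_ isT) HG.
set G := \sum_(m < M.+1) _ in HG *.
have -> : expR A - G = expR P * (expR (A - P) - 1) - (G - expR P).
  by rewrite mulrBr mulr1 -expRD subrKC; ring.
rewrite (le_trans (ler_normB _ _)) // mulrDl lerD //.
have tM : t ^+ M.+1 <= 1 by rewrite exprn_ile1.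
have tM0 : 0 <= t ^+ M.+1 by rewrite exprn_ge0.
rewrite normrM (ger0_norm (expR_ge0 _)) -mulrA; apply: ler_pM => //.
- rewrite ler_expR (le_trans (ler_norm _)) // (le_trans (ler_norm_sum _ _ _)) //.
  have -> : M%:R * B = \sum_(m < M) B by rewrite sumr_const card_ord mulr_natl.
  apply: ler_sum => m _; rewrite normrM normrX (ger0_norm t0) -[leRHS]mulr1.
  by apply: ler_pM; rewrite ?exprn_ge0 ?exprn_ile1 // Ba /=.
apply: (le_trans (expRB1_norm _)).
have -> : C1 * expR C1 * t ^+ M.+1 = C1 * t ^+ M.+1 * expR C1 by ring.
apply: ler_pM => //.
by rewrite ler_expR (le_trans HA) // ler_piMr.
Qed.

End ExponentialExpansion.

(** * Adding up the nine Stirling series *)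

Section LogExpansion.
Variable R : realType.
Implicit Types (h k e N : R) (M m : nat).

Lemma stirling_coef_reflect m h :
  stirling_coef m (1 - h) = (-1) ^+ m.+1 * stirling_coef m h.
Proof.
rewrite /stirling_coef bernoulli_poly_reflect.
by rewrite (mulrA ((-1) ^+ m.+1) (_ * _)).
Qed.

(** The sign (-1)^(m+1) in [Xihat] is exactly what reflection produces for the cells b and c, whose
    shift is 1 - h. The -1 beside [W] comes from the factorial of N. *)
Lemma atilde_stirling_coef k e h m :
  atilde k e h m = stirling_coef m 0 * (W k e m - 1)
   - stirling_coef m h * (cella k e ^- m + celld k e ^- m)
   - stirling_coef m (1 - h) * (cellb k e ^- m + cellc k e ^- m).
Proof.
rewrite stirling_coef_reflect /atilde /Xihat /stirling_coef /bernoulli_num.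
move: (bernoulli_poly _ _) (bernoulli_poly _ _) (W _ _ _) => b0 bh w.
move: (_ + _) (_ + _) (_^-1) ((-1) ^+ _) => x y z s; ring.
Qed.

(* The expansions of the nine logarithms of factorials add up; 4 - 1 - 4 = -1
   copies of the constant ln (2 pi) / 2 remain. *)
Lemma stirling_combination M k e h N : 0 < N -> 0 < k < 1 -> 0 < e < 1 ->
  let S := stirling M in
  ln 2 - ln N
  + ((ln (N * k) + S 0 (N * k)) + (ln (N * (1 - k)) + S 0 (N * (1 - k)))
     + (ln (N * e) + S 0 (N * e)) + (ln (N * (1 - e)) + S 0 (N * (1 - e))))
  - (ln N + S 0 N)
  - (S h (N * cella k e) + S h (N * celld k e)
     + S (1 - h) (N * cellb k e) + S (1 - h) (N * cellc k e))
  - ln (2 * pi) / 2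
  = ln (2 * N * cella k e * celld k e / pi) / 2
    + \sum_(m < M) atilde k e h m.+1 * N^-1 ^+ m.+1.
Proof.
move=> N0 /andP[k0 k1] /andP[e0 e1] S.
have k10 : 0 < 1 - k by lra.
have e10 : 0 < 1 - e by lra.
have p0 := pi_gt0 R.
pose s h x : R := \sum_(m < M) stirling_coef m.+1 h / x ^+ m.+1.
have -> : \sum_(m < M) atilde k e h m.+1 * N^-1 ^+ m.+1 =
    (s 0 (N * k) + s 0 (N * (1 - k)) + s 0 (N * e) + s 0 (N * (1 - e))) - s 0 N
    - (s h (N * cella k e) + s h (N * celld k e)
       + s (1 - h) (N * cellb k e) + s (1 - h) (N * cellc k e)).
  rewrite -!big_split -!sumrB; apply: eq_bigr => m _ /=.
  rewrite atilde_stirling_coef /W !exprMn !invfM exprVn.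
  move: (stirling_coef _ 0) (stirling_coef _ h) (stirling_coef _ (1 - h)).
  move=> s0 sh sh1; ring.
rewrite /S /stirling -!/(s _ _).
move: (s 0 _) (s 0 _) (s 0 _) (s 0 _) (s 0 _) (s h _) (s h _) => s1 s2 s3 s4 s5 s6 s7.
move: (s _ _) (s _ _) => s8 s9.
rewrite /cella /cellb /cellc /celld.
(* Since a+b = kappa, a+c = eta and so on, the terms of order N cancel. Each of kappa, 1-kappa, eta,
   1-eta divides one cell shifted by h and one shifted by 1-h, so h drops out and its logarithm
   keeps the coefficient 1/2. *)
rewrite ln_div ?posrE ?mulr_gt0 // !lnM ?posrE ?mulr_gt0 //.
by field.
Qed.

End LogExpansion.

(** * The tail at [nu] as a quotient of factorials *)

Section HypergeometricFactorials.
Variable R : realType.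
Variables N K n nu : nat.
Hypotheses (KN : (K <= N)%N) (nN : (n <= N)%N) (nu0 : (0 < nu)%N)
  (nuK : (nu <= K)%N) (nun : (nu <= n)%N) (KnN : (K + n < N + nu)%N).

Let q := (N + nu - K - n)%N.

(** The two linear factors of the tail turn nu! and q! into (nu-1)! and (q-1)!. This is why the
    cells a and d receive the shift h, whereas (K-nu)! and (n-nu)! give 1-h for b and c. *)
Lemma hyp_tail_fact :
  hyp_tail R N K n nu * (N%:R * N`!%:R * (nu.-1`!%:R * q.-1`!%:R
    * (K - nu)`!%:R * (n - nu)`!%:R))
  = K`!%:R * (N - K)`!%:R * n`!%:R * (N - n)`!%:R.
Proof.
have q0 : (0 < q)%N by rewrite /q; lia.
have qR : N%:R - K%:R - n%:R + nu%:R = q%:R :> R.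
  by rewrite /q !natrB ?natrD; [ring|lia|lia].
have b1 := bin_fact nuK.
have nnuNK : (n - nu <= N - K)%N by lia.
have b2 := bin_fact nnuNK.
have b3 := bin_fact nN.
rewrite (_ : (N - K - (n - nu) = q)%N) in b2; last by rewrite /q; lia.
rewrite (fact_pred nu0) in b1; rewrite (fact_pred q0) in b2.
rewrite /hyp_tail /hyp_pmf nun qR.
have c0 : 'C(N, n)%:R != 0 :> R by rewrite pnatr_eq0 -lt0n bin_gt0.
have N0 : N%:R != 0 :> R by rewrite pnatr_eq0 -lt0n; lia.
move: b1 b2 b3 c0; move: 'C(K, nu) 'C(N - K, n - nu) 'C(N, n) => c1 c2 c3.
move: K`! (N - K)`! n`! (N - n)`! N`! nu.-1`! q.-1`! (K - nu)`! (n - nu)`!.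
move=> f1 f2 f3 f4 f5 f6 f7 f8 f9 <- <- <- c0.
by rewrite !natrM; field; rewrite c0 N0.
Qed.

(** [lg m] is ln Gamma(m), so ln m! is ln m + [lg m] or [lg m.+1]. The first form suits shift 0, the
    second the shift 1 - h. *)
Let lg (m : nat) : R := ln (m.-1`!%:R).

Lemma hyp_tail_gt0 : 0 < hyp_tail R N K n nu.
Proof.
have N0 : (0 < N)%N by lia.
have F m : 0 < m`!%:R :> R by rewrite ltr0n fact_gt0.
have P : 0 < N%:R * N`!%:R * (nu.-1`!%:R * q.-1`!%:R
    * (K - nu)`!%:R * (n - nu)`!%:R) :> R by rewrite !mulr_gt0 ?F ?ltr0n.
rewrite -(pmulr_lgt0 _ P) hyp_tail_fact; by rewrite !mulr_gt0 ?F.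
Qed.

Lemma ln_hyp_tail : (K < N)%N -> (n < N)%N ->
  ln (2 * hyp_tail R N K n nu) = ln 2 - ln N%:R
  + ((ln K%:R + lg K) + (ln (N - K)%:R + lg (N - K))
     + (ln n%:R + lg n) + (ln (N - n)%:R + lg (N - n)))
  - (ln N%:R + lg N)
  - (lg nu + lg q + lg (K - nu).+1 + lg (n - nu).+1).
Proof.
move=> KN' nN'; have N0 : (0 < N)%N by lia.
have NK0 : (0 < N - K)%N by lia.
have Nn0 : (0 < N - n)%N by lia.
have K0 : (0 < K)%N by lia.
have n0 : (0 < n)%N by lia.
have F m : 0 < m`!%:R :> R by rewrite ltr0n fact_gt0.
have lf m : (0 < m)%N -> ln (m`!%:R) = ln m%:R + lg m.
  by move=> m0; rewrite (fact_pred m0) natrM lnM ?posrE ?F ?ltr0n.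
have NR : 0 < N%:R :> R by rewrite ltr0n.
move: hyp_tail_fact hyp_tail_gt0; move: (hyp_tail _ _ _ _ _) => T.
move=> /(congr1 (@ln R)) + t0.
rewrite !lnM ?posrE ?mulr_gt0 ?F ?ltr0n //.
rewrite (lf _ N0) (lf _ K0) (lf _ n0) (lf _ NK0) (lf _ Nn0).
rewrite /lg -!pred_Sn => E; lra.
Qed.

End HypergeometricFactorials.

(** * Uniform bounds and the asymptotics of the tail *)

Section UniformAsymptotics.
Variable R : realType.
Implicit Types (eps h k e : R) (M m N K n nu : nat).

(** All proportions and cells are at least eps^2, so their inverse m-th powers are at most [V m].
    The count [8 * V m + 1] is four proportions, the -1 and four cells; the sum over m serves as a
    maximum. *)
Lemma atilde_bounded M eps : 0 < eps -> exists2 B : R, 0 <= B &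
  forall k e h, eps <= k <= 1 - eps -> eps <= e <= 1 - eps -> 0 <= h <= 1 ->
  forall m, (0 < m <= M)%N -> `|atilde k e h m| <= B.
Proof.
move=> eps0.
have /choice[D HD] : forall m, exists D : R, 0 <= D /\
    forall h, 0 <= h <= 1 -> `|stirling_coef m h| <= D.
  by move=> m; have [D ? ?] := stirling_coef_bounded R m; exists D.
pose V m : R := (eps ^+ 2) ^- m.
have V0 m : 0 <= V m by rewrite invr_ge0 exprn_ge0 // exprn_ge0 // ltW.
have D0 m : 0 <= D m by have [] := HD m.
have DV m : 0 <= D m * (8 * V m + 1) by rewrite mulr_ge0 // addr_ge0 // mulr_ge0.
exists (\sum_(m < M.+1) D m * (8 * V m + 1)); first exact: sumr_ge0.
move=> k e h /andP[k1 k2] /andP[e1 e2] h01 m /andP[_ mM].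
apply: (@le_trans _ _ (D m * (8 * V m + 1))); last first.
  rewrite (bigD1 (Ordinal (mM : (m < M.+1)%N))) //= lerDl.
  by apply: sumr_ge0.
have inv x : eps ^+ 2 <= x -> 0 <= x ^- m <= V m.
  move=> x1; have e20 : 0 < eps ^+ 2 by rewrite exprn_gt0.
  have x0 : 0 < x by apply: lt_le_trans x1.
  rewrite invr_ge0 (exprn_ge0 _ (ltW x0)) /= lef_pV2 ?posrE ?exprn_gt0 //.
  by rewrite lerXn2r // nnegrE; exact: ltW.
have eps1 : eps <= 1 by lra.
have sq x y : eps <= x -> eps <= y -> eps ^+ 2 <= x * y.
  by move=> *; rewrite expr2; apply: ler_pM => //; exact: ltW.
have sq1 x : eps <= x -> eps ^+ 2 <= x.
  by move=> ex; apply: le_trans ex; rewrite expr2 ler_piMl // ltW.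
have k3 : eps <= 1 - k by lra.
have e3 : eps <= 1 - e by lra.
have /andP[w1 w1'] := inv _ (sq1 _ k1); have /andP[w2 w2'] := inv _ (sq1 _ k3).
have /andP[w3 w3'] := inv _ (sq1 _ e1); have /andP[w4 w4'] := inv _ (sq1 _ e3).
have /andP[x1 x1'] := inv _ (sq _ _ k1 e1).
have /andP[x2 x2'] := inv _ (sq _ _ k1 e3).
have /andP[x3 x3'] := inv _ (sq _ _ e1 k3).
have /andP[x4 x4'] := inv _ (sq _ _ k3 e3).
have [_ Hm] := HD m; have h1 : 0 <= 1 - h <= 1 by lra.
have z01 : 0 <= (0 : R) <= 1 by rewrite lexx ler01.
have := Hm h h01; have := Hm _ h1; have := Hm 0 z01.
rewrite atilde_stirling_coef /W /cella /cellb /cellc /celld.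
move: (stirling_coef m 0) (stirling_coef m h) (stirling_coef m (1 - h)).
move=> s0 sh sh1 b0 bh1 bh.
apply: (le_trans (ler_normB _ _)).
apply: (le_trans (lerD (ler_normB _ _) (lexx _))).
rewrite (normrM s0) (normrM sh) (normrM sh1).
have P x y z : `|x| <= D m -> `|y| <= z -> `|x| * `|y| <= D m * z.
  by move=> ? ?; apply: ler_pM.
have -> : D m * (8 * V m + 1) = D m * (4 * V m + 1) + D m * (2 * V m)
   + D m * (2 * V m) by ring.
apply: lerD; [apply: lerD|]; apply: P => //; rewrite ler_norml.
- by apply/andP; split; lra.
- by apply/andP; split; lra.
- by apply/andP; split; lra.
Qed.

Lemma compact_pos_lower_bound (T : topologicalType) (A : set T) (g : T -> R) :
  compact A -> continuous g -> (forall x, A x -> 0 < g x) ->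
  exists2 eps : R, 0 < eps & forall x, A x -> eps <= g x.
Proof.
move=> cA cg gp; have [->|A0] := eqVneq A set0; first by exists 1.
have [|x] := compact_EVT_min _ cA (continuous_subspaceT cg); first exact/set0P.
rewrite inE => Ax xmin; exists (g x); first exact: gp.
by move=> y Ay; apply: xmin; rewrite inE.
Qed.

Lemma compact_open_square (A : set (R * R)) : compact A ->
  (forall p : R * R, A p -> 0 < p.1 < 1 /\ 0 < p.2 < 1) ->
  exists2 eps : R, 0 < eps &
    forall p, A p -> eps <= p.1 <= 1 - eps /\ eps <= p.2 <= 1 - eps.
Proof.
move=> cA sA.
have cf : continuous (fst : R * R -> R) by move=> p; exact: cvg_fst.
have cs : continuous (snd : R * R -> R) by move=> p; exact: cvg_snd.
have c1 (g : R * R -> R) : continuous g -> continuous (fun p => 1 - g p).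
  by move=> cg p; apply: cvgB; [exact: cvg_cst|exact: cg].
have [p /sA[/andP[] //]|e1 e10 E1] := compact_pos_lower_bound cA cf.
have [p /sA[_ /andP[] //]|e2 e20 E2] := compact_pos_lower_bound cA cs.
have [p /sA[/andP[_]]|e3 e30 E3] := compact_pos_lower_bound cA (c1 _ cf).
  by rewrite subr_gt0.
have [p /sA[_ /andP[_]]|e4 e40 E4] := compact_pos_lower_bound cA (c1 _ cs).
  by rewrite subr_gt0.
exists (Num.min (Num.min e1 e2) (Num.min e3 e4)); first by rewrite !lt_min e10 e20 e30.
move=> p Ap; set mn := Num.min _ _.
have m1 : mn <= e1 by rewrite /mn !ge_min lexx.
have m2 : mn <= e2 by rewrite /mn !ge_min lexx !orbT.
have m3 : mn <= e3 by rewrite /mn !ge_min lexx !orbT.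
have m4 : mn <= e4 by rewrite /mn !ge_min lexx !orbT.
have := E1 p Ap; have := E2 p Ap; have := E3 p Ap; have := E4 p Ap.
by split; apply/andP; split; lra.
Qed.

Lemma sqrt_expR_ln (x : R) : 0 < x -> Num.sqrt x = expR (ln x / 2).
Proof.
move=> x0; have -> : Num.sqrt x = Num.sqrt (expR (ln x / 2) ^+ 2).
  by rewrite -expRM_natl mulrC divfK // lnK.
by rewrite sqrtr_sqr ger0_norm // expR_ge0.
Qed.

Lemma hyp_tail_asymptotic M eps : 0 < eps -> exists (C : R) (N0 : nat),
  forall N K n nu, (N0 <= N)%N ->
  let k := K%:R / N%:R in
  let e := n%:R / N%:R in
  let h := nu%:R - hyp_mean R N K n in
  eps <= k <= 1 - eps -> eps <= e <= 1 - eps -> 0 <= h <= 1 ->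
  `|2 * hyp_tail R N K n nu / Num.sqrt (2 * N%:R * cella k e * celld k e / pi)
    - \sum_(m < M.+1) delta k e h m / N%:R ^+ m| <= C * N%:R ^- M.+1.
Proof.
move=> eps0; have [B B0 HB] := atilde_bounded M eps0.
have [A A0 HA] := stirling_shifted R M.
pose th := eps ^+ 2; have th0 : 0 < th by rewrite exprn_gt0.
(* Nine factorials, each with x >= [th] N. *)
pose C1 := 9 * (A * th ^- M.+1).
have Ath0 : 0 <= A * th ^- M.+1 by rewrite mulr_ge0 // invr_ge0 exprn_ge0 // ltW.
have C10 : 0 <= C1 by rewrite mulr_ge0.
have [C C0 HC] := expR_asymptotic M B0 C10.
(* This threshold gives N [th] >= 2, so every integer fed to [stirling_shifted] is at least 2. *)
exists C, (Num.bound (2 / th)).+1 => N K n nu N0N k e h k01 e01 h01.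
have /andP[k0 k1] := k01; have /andP[e0 e1] := e01; have /andP[h0 h1] := h01.
have N0 : (0 < N)%N by apply: leq_trans N0N.
have NR : 0 < N%:R :> R by rewrite ltr0n.
have NRn : N%:R != 0 :> R by rewrite gt_eqF.
have Nth : 2 <= N%:R * th.
  rewrite -ler_pdivrMr //; have b0 : 0 <= 2 / th by rewrite divr_ge0 // ltW.
  apply: (le_trans (ltW (archi_boundP b0))); rewrite ler_nat; exact: ltnW.
have eps1 : eps <= 1 by lra.
have big x y : eps <= x -> eps <= y -> th <= x * y.
  by move=> *; rewrite /th expr2; apply: ler_pM => //; exact: ltW.
have big1 x : eps <= x -> th <= x.
  by move=> ex; apply: le_trans ex; rewrite /th expr2 ler_piMl // ltW.
have k3 : eps <= 1 - k by lra.
have e3 : eps <= 1 - e by lra.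
have Nbig y : th <= y -> 2 <= N%:R * y.
  by move=> ty; apply: (le_trans Nth); rewrite ler_wpM2l.
have KE : K%:R = N%:R * k by rewrite /k mulrC divfK.
have nE : n%:R = N%:R * e by rewrite /e mulrC divfK.
have hE : nu%:R = N%:R * cella k e + h.
  by rewrite /h /hyp_mean /cella KE nE; field.
have xa : th <= cella k e by apply: big.
have xb : th <= cellb k e by apply: big.
have xc : th <= cellc k e by apply: big.
have xd : th <= celld k e by apply: big.
have Na := Nbig _ xa; have Nb := Nbig _ xb.
have Nc := Nbig _ xc; have Nd := Nbig _ xd.
have cab : N%:R * k = N%:R * cella k e + N%:R * cellb k e.
  by rewrite /cella /cellb; ring.
have cac : N%:R * e = N%:R * cella k e + N%:R * cellc k e.
  by rewrite /cella /cellc; ring.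
have cN : N%:R = N%:R * cella k e + N%:R * cellb k e + N%:R * cellc k e
   + N%:R * celld k e :> R by rewrite /cella /cellb /cellc /celld; ring.
(* N times each cell is at least 2 while h <= 1: this margin yields all the integer inequalities
   below, and no natural subtraction truncates. *)
have KN : (K < N)%N by rewrite -(ltr_nat R) KE; lra.
have nN : (n < N)%N by rewrite -(ltr_nat R) nE; lra.
have nu0 : (0 < nu)%N by rewrite -(ltr_nat R) hE; lra.
have nuK : (nu <= K)%N by rewrite -(ler_nat R) hE KE; lra.
have nun : (nu <= n)%N by rewrite -(ler_nat R) hE nE; lra.
have KnN : (K + n < N + nu)%N by rewrite -(ltr_nat R) !natrD hE KE nE; lra.
pose q := (N + nu - K - n)%N.
have qE : q%:R = N%:R * celld k e + h.
  have q1 : (K <= N + nu)%N by rewrite (leq_trans (ltnW KN)) ?leq_addr.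
  have q2 : (n <= N + nu - K)%N by rewrite leq_subRL // ltnW.
  rewrite /q (natrB _ q2) (natrB _ q1) natrD.
  by rewrite KE nE hE /cella /celld; ring.
have NKE : (N - K)%:R = N%:R * (1 - k) by rewrite (natrB _ (ltnW KN)) KE; ring.
have NnE : (N - n)%:R = N%:R * (1 - e) by rewrite (natrB _ (ltnW nN)) nE; ring.
have KnuE : (K - nu).+1%:R = N%:R * cellb k e + (1 - h).
  by rewrite -(natr1 (K - nu)) natrB // KE hE; lra.
have nnuE : (n - nu).+1%:R = N%:R * cellc k e + (1 - h).
  by rewrite -(natr1 (n - nu)) natrB // nE hE; lra.
pose t : R := N%:R^-1; pose E := A * th ^- M.+1 * t ^+ M.+1.
have lgS p y g : th <= y -> 0 <= g <= 1 -> p%:R = N%:R * y + g ->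
    `|ln (p.-1`!%:R) - stirling M g (N%:R * y) - ln (2 * pi) / 2| <= E.
  move=> ty g01 pE; have /andP[g0 g1] := g01; have Ny := Nbig _ ty.
  have p2 : (2 <= p)%N by rewrite -(ler_nat R) pE; lra.
  have := HA g p g01 p2; rewrite pE addrK => H; apply: (le_trans H).
  have Nth0 : 0 < N%:R * th by rewrite mulr_gt0.
  have Ny0 : 0 < N%:R * y by exact: lt_le_trans Ny.
  rewrite /E -mulrA ler_wpM2l // /t exprVn -invfM -exprMn (mulrC th).
  rewrite lef_pV2 ?posrE ?exprn_gt0 // lerXn2r ?nnegrE ?(ltW Nth0) ?(ltW Ny0) //.
  by rewrite ler_wpM2l // ltW.
have z01 : 0 <= (0 : R) <= 1 by rewrite lexx ler01.
have h'01 : 0 <= 1 - h <= 1 by rewrite subr_ge0 h1 lerBlDr lerDl.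
have L1 := lgS K k 0 (big1 _ k0) z01; rewrite addr0 in L1.
have L2 := lgS (N - K)%N (1 - k) 0 (big1 _ k3) z01; rewrite addr0 in L2.
have L3 := lgS n e 0 (big1 _ e0) z01; rewrite addr0 in L3.
have L4 := lgS (N - n)%N (1 - e) 0 (big1 _ e3) z01; rewrite addr0 in L4.
have L5 := lgS N 1 0 (big1 _ eps1) z01; rewrite addr0 mulr1 in L5.
have L6 := lgS nu (cella k e) h xa h01 hE.
have L7 := lgS q (celld k e) h xd h01 qE.
have L8 := lgS _ (cellb k e) (1 - h) xb h'01 KnuE.
have L9 := lgS _ (cellc k e) (1 - h) xc h'01 nnuE.
have {}L1 := L1 KE; have {}L2 := L2 NKE; have {}L3 := L3 nE.
have {}L4 := L4 NnE; have {}L5 := L5 erefl.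
have k01' : 0 < k < 1.
  by rewrite (lt_le_trans eps0 k0) -subr_gt0 (lt_le_trans eps0 k3).
have e01' : 0 < e < 1.
  by rewrite (lt_le_trans eps0 e0) -subr_gt0 (lt_le_trans eps0 e3).
have SC := stirling_combination M h NR k01' e01'.
have T0 := hyp_tail_gt0 R (ltnW KN) (ltnW nN) nu0 nuK nun KnN.
have LT := ln_hyp_tail R (ltnW KN) (ltnW nN) nu0 nuK nun KnN KN nN.
rewrite -/q KE NKE nE NnE in LT.
set z := 2 * N%:R * cella k e * celld k e / pi in SC *.
have ca0 : 0 < cella k e by exact: lt_le_trans xa.
have cd0 : 0 < celld k e by exact: lt_le_trans xd.
have z0 : 0 < z.
  by rewrite /z divr_gt0 ?pi_gt0 // mulr_gt0 // mulr_gt0 // mulr_gt0.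
have := HC (atilde k e h) (HB _ _ _ k01 e01 h01) t
  (ln (2 * hyp_tail R N K n nu) - ln z / 2).
have t01 : 0 <= t <= 1.
  have N2 : 2 <= N%:R :> R by have := Nbig 1 (big1 _ eps1); rewrite mulr1.
  by rewrite /t invr_ge0 (ltW NR) /= invf_le1 // (le_trans _ N2) // ler1n.
move=> /(_ t01).
have -> : expR (ln (2 * hyp_tail R N K n nu) - ln z / 2) =
    2 * hyp_tail R N K n nu / Num.sqrt z.
  by rewrite (sqrt_expR_ln z0) expRB lnK // posrE mulr_gt0.
have -> : \sum_(m < M.+1) exp_coef (atilde k e h) m * t ^+ m =
    \sum_(m < M.+1) delta k e h m / N%:R ^+ m.
  by apply: eq_bigr => m _; rewrite /t exprVn.
rewrite /t exprVn; apply; rewrite -/t -exprVn -/t.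
have -> : C1 * t ^+ M.+1 = 9 * E by rewrite /C1 /E; ring.
(* [LT] and [SC] are exact identities, so the difference to be bounded is a signed sum of nine
   errors of size at most [E]. *)
rewrite LT; move: SC; rewrite -/t.
move: L1 L2 L3 L4 L5 L6 L7 L8 L9; clear; cbv zeta.
move: (ln (K.-1`!%:R)) (ln ((N - K).-1`!%:R)) (ln (n.-1`!%:R))
  (ln ((N - n).-1`!%:R)) (ln (N.-1`!%:R)) (ln (nu.-1`!%:R)) (ln (q.-1`!%:R))
  (ln ((K - nu).+1.-1`!%:R)) (ln ((n - nu).+1.-1`!%:R)).
move=> g1 g2 g3 g4 g5 g6 g7 g8 g9.
move: (stirling M 0 (N%:R * k)) (stirling M 0 (N%:R * (1 - k)))
  (stirling M 0 (N%:R * e)) (stirling M 0 (N%:R * (1 - e))) (stirling M 0 N%:R)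
  (stirling M h _) (stirling M h _) (stirling M (1 - h) _)
  (stirling M (1 - h) _).
move=> s1 s2 s3 s4 s5 s6 s7 s8 s9.
move: (ln N%:R) (ln (N%:R * k)) (ln (N%:R * (1 - k))) (ln (N%:R * e))
  (ln (N%:R * (1 - e))) (ln z / 2) (ln (2 * pi) / 2) (ln 2)
  (\sum_(m < M) _) E.
move=> l1 l2 l3 l4 l5 l6 l7 l8 S {}E; clear.
rewrite !ler_norml => /andP[a1 b1] /andP[a2 b2] /andP[a3 b3] /andP[a4 b4].
move=> /andP[a5 b5] /andP[a6 b6] /andP[a7 b7] /andP[a8 b8] /andP[a9 b9] SC.
by apply/andP; split; lra.
Qed.

End UniformAsymptotics.

(** * Admissible parameters and the ceiling of the mean *)

Section Proportions.
Variable R : realType.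
Variables N K n : nat.
Hypotheses (k01 : 0 < (K%:R / N%:R : R) < 1) (e01 : 0 < (n%:R / N%:R : R) < 1).

(* Division by zero yields 0, so that k01 forces N > 0. *)
Lemma proportion_lt : (0 < K < N)%N /\ (0 < n < N)%N.
Proof.
have /andP[k0 k1] := k01; have /andP[e0 e1] := e01.
have N0 : (0 < N)%N.
  by case: (posnP N) k0 => // ->; rewrite invr0 mulr0 ltxx.
have NR : 0 < N%:R :> R by rewrite ltr0n.
move: k0 k1 e0 e1; rewrite !ltr_pdivlMr // !ltr_pdivrMr // !mul0r !mul1r.
by rewrite !ltr0n !ltr_nat => -> -> -> ->.
Qed.

(** The mean lies in [0, n], so its integer ceiling is a natural index of the sum; the last two
    clauses are the separation that [hyp_sum_abs_dev] expects. *)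
Lemma hyp_mean_ceil : exists2 nu : nat, (nu <= n)%N &
  [/\ hyp_frac R N K n = nu%:R - hyp_mean R N K n,
      0 <= hyp_frac R N K n < 1,
      forall k, (k < nu)%N -> k%:R <= hyp_mean R N K n &
      forall k, (nu <= k)%N -> hyp_mean R N K n <= k%:R].
Proof.
have [/andP[K0 KN] /andP[n0 nN]] := proportion_lt.
have N0 : (0 < N)%N by apply: leq_trans KN.
have NR : 0 < N%:R :> R by rewrite ltr0n.
rewrite /hyp_frac; set mu := hyp_mean R N K n.
have mu0 : 0 <= mu by rewrite /mu /hyp_mean divr_ge0 ?mulr_ge0.
have mun : mu <= n%:R.
  by rewrite /mu /hyp_mean ler_pdivrMr // ler_wpM2l // ler_nat ltnW.
have c0 : 0 <= Num.ceil mu by rewrite ceil_ge0 (lt_le_trans (ltrN10 R)).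
have /andP[lo hi] := ceil_itv mu.
have cE : Num.ceil mu = (`|Num.ceil mu|%N : int) by rewrite gez0_abs.
have gt k : (k < `|Num.ceil mu|)%N = (k%:R < mu).
  by rewrite -ltz_nat -cE ceil_gt_int.
have le k : (`|Num.ceil mu| <= k)%N = (mu <= k%:R).
  by rewrite -lez_nat -cE ceil_le_int.
exists `|Num.ceil mu|%N; first by rewrite le.
split.
- by rewrite {1}cE.
- by move: lo hi; rewrite intrB /= => lo hi; apply/andP; split; lra.
- by move=> k; rewrite gt => /ltW.
- by move=> k; rewrite le.
Qed.

End Proportions.


Theorem theorem6p1 (R : realType) (C : set (R * R)) (hC : compact C)
    (hsub : forall p : R * R, C p -> 0 < p.1 < 1 /\ 0 < p.2 < 1) :
  (forall M : nat, exists (A : R) (N0 : nat), forall N K n : nat,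
     let kappa := K%:R / N%:R in
     let eta := n%:R / N%:R in
     let mu := hyp_mean R N K n in
     let h := hyp_frac R N K n in
     (N0 <= N)%N -> C (kappa, eta) ->
     forall (d : measure_display) (T : measurableType d)
       (P : probability T R) (X : {RV P >-> R}),
     has_hyp_law X N K n ->
     (`| 'E_P[fun w => `|X w - mu|%R]
           * (Num.sqrt (2 * N%:R * cella kappa eta * celld kappa eta / pi))^-1%:E
         - (\sum_(0 <= m < M.+1) delta kappa eta h m / N%:R ^+ m)%:E |
      <= (A * N%:R ^- M.+1)%:E)%E)
  /\
  (forall N K n : nat,
     let kappa := K%:R / N%:R in
     let eta := n%:R / N%:R in
     let mu := hyp_mean R N K n in
     let sigma2 := hyp_var R N K n in
     let h := hyp_frac R N K n in
     let a := cella kappa eta in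
     let d := celld kappa eta in
     C (kappa, eta) ->
     [/\ forall (disp : measure_display) (T : measurableType disp)
           (P : probability T R) (X : {RV P >-> R}),
           has_hyp_law X N K n ->
           ('E_P[X] = mu%:E)%E /\ ('V_P[X] = sigma2%:E)%E,
         0 <= h < 1,
         N%:R * a * d
           = n%:R * K%:R * (N%:R - K%:R) * (N%:R - n%:R) / N%:R ^+ 3,
         N%:R * a * d = sigma2 * (N%:R - 1) / N%:R
       & atilde kappa eta h 1
           = 12^-1 * ((kappa * (1 - kappa))^-1 + (eta * (1 - eta))^-1 - 1)
             - bernoulli_poly 2 h / (2 * a * d)]).
Proof.
have [eps eps0 Heps] := compact_open_square hC hsub.
split=> [M|N K n kappa eta mu sigma2 h a d CN].
  have [A [N0 HA]] := hyp_tail_asymptotic M eps0.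
  exists A, N0 => N K n kappa eta mu h NN0 CN d T P X hX.
  have [k01 e01] := hsub _ CN; have [kI eI] := Heps _ CN.
  have [/andP[K0 KN] /andP[n0 nN]] := proportion_lt k01 e01.
  have [nu nun [hE hI lo hi]] := hyp_mean_ceil k01 e01.
  have N1 : (0 < N)%N by apply: leq_trans KN.
  have mg : measurable_fun [set: R] (fun x : R => `|x - mu|).
    by apply: measurableT_comp => //; exact: measurable_funB.
  rewrite (hyp_expectation (ltnW KN) (ltnW nN) hX mg).
  rewrite (hyp_sum_abs_dev (ltnW KN) N1 (leqW nun) lo hi).
  rewrite -EFinM -EFinB abse_EFin lee_fin big_mkord /h hE.
  apply: HA => //; rewrite -hE; have /andP[-> /ltW ->] := hI; exact: isT.
have [k01 e01] := hsub _ CN.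
have [/andP[K0 KN] /andP[n0 nN]] := proportion_lt k01 e01.
have [nu nun [hE hI lo hi]] := hyp_mean_ceil k01 e01.
have N1 : (1 < N)%N by apply: leq_trans KN.
have N0 : N%:R != 0 :> R by rewrite pnatr_eq0 -lt0n ltnW.
have N10 : N%:R - 1 != 0 :> R by rewrite subr_eq0 pnatr_eq1 gtn_eqF.
split => //.
- move=> disp T P X hX.
  have EX : ('E_P[X] = mu%:E)%E.
    have mid : measurable_fun [set: R] (fun x : R => x) by exact: measurable_id.
    have := hyp_expectation (ltnW KN) (ltnW nN) hX mid.
    by rewrite hyp_sum_mean // ltnW.
  split => //; rewrite /variance unlock EX /=.
  have mg : measurable_fun [set: R] (fun x : R => (x - mu) ^+ 2).
    by apply: measurable_funX; exact: measurable_funB.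
  have -> : ((X \- cst mu) * (X \- cst mu))%R = (fun w => (X w - mu) ^+ 2).
    by apply/funext => w; rewrite /= expr2.
  rewrite (hyp_expectation (ltnW KN) (ltnW nN) hX mg).
  by rewrite hyp_sum_variance // ltnW.
- by rewrite /a /d /cella /celld /kappa /eta; field.
- by rewrite /a /d /cella /celld /kappa /eta /sigma2 /hyp_var; field; rewrite N0 N10.
(* For m = 1 the sign in [Xihat] is +1, and 1/a + 1/b + 1/c + 1/d = 1/(ad), while [W] is
   1/(kappa(1-kappa)) + 1/(eta(1-eta)) and B_2 = 1/6. *)
- rewrite /atilde /W /Xihat /bernoulli_num !bernoulli_poly2 /a /d.
  have {k01}/andP[k0 k1] : 0 < kappa < 1 := k01.
  have {e01}/andP[e0 e1] : 0 < eta < 1 := e01.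
  rewrite /cella /cellb /cellc /celld !expr1.
  by field; repeat (apply/andP; split); lra.
Qed.
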